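(* Let $\Gamma$ be a countable set, let $m_k,\nu_k>0$ ($k\in\Gamma$) be constants, and let $V_{kl}:\mathbb{R}^d\to\mathbb{R}$ ($k,l\in\Gamma$) be functions satisfying the following conditions: (i) $V_{kl}(x)=V_{lk}(-x)$ for all $k,l\in\Gamma$, $x\in\mathbb{R}^d$; (ii) $V_{kl}\in C_0^\infty(\mathbb{R}^d,\mathbb{R})$ for all $k,l\in\Gamma$; (iii a) there exist constants $C\ge 0$ and $C_{kl}\ge 0$ ($k,l\in\Gamma$) such that $\|\partial^\beta V_{kl}\|_\infty\le C_{kl}C^{|\beta|}$ for all multi-indices $\beta:\{1,\dots,d\}\to\mathbb{Z}_{\ge0}$; (iii b) $\sup_{k\in\Gamma}\sum_{l\in\Gamma}C_{kl}<\infty$; (iv) $\sup_{k\in\Gamma}\{m_k\nu_k,\,1/(m_k\nu_k)\}<\infty$. Let $(\alpha^t)_{t\in\mathbb{R}}$ be the associated infinite-volume time evolution on $C_{\mathcal R}(\Omega)$, and let $$\mathfrak{L}=C^*\Big(\bigcup_{t\in\mathbb{R}}\alpha^t(\mathfrak{K})\Big)\subset C_{\mathcal R}(\Omega).$$ Then $(\mathfrak{L},\alpha^{\mathbb{R}}|_{\mathfrak{L}})$ is a C*-dynamical system; i.e., the map $\mathbb{R}\to\mathrm{Aut}(\mathfrak{L})$, $t\mapsto\alpha^t|_{\mathfrak{L}}$, is a well-defined strongly continuous group homomorphism.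
   Context: $d\ge1$ is a fixed integer. $C_0^\infty(\mathbb{R}^d,\mathbb{R})$ denotes the smooth real-valued functions vanishing at infinity. Phase space: $\Omega$ is the space of pairs $(p,q)$ of finitely supported sequences $p=(p_k)_{k\in\Gamma}$, $q=(q_k)_{k\in\Gamma}$ with $p_k,q_k\in\mathbb{R}^d$, with the inner product inherited from $\ell^2(\Gamma,\mathbb{R}^{2d})$. For finite $\Lambda\subset\Gamma$, $\Omega_\Lambda=\{(p,q)\in\Omega: p_k=q_k=0 \text{ for } k\notin\Lambda\}\cong\mathbb{R}^{2|\Lambda|d}$, and $\pi_\Lambda:\Omega\to\Omega_\Lambda$ is the orthogonal projection; $\pi_\Lambda^*f=f\circ\pi_\Lambda$. Commutative resolvent algebra: for a real inner product space $X$, $C_{\mathcal R}(X)$ is the C*-subalgebra of $C_b(X)$ (bounded continuous complex functions, sup norm) generated by the functions $h_x^\lambda(y)=1/(i\lambda-x\cdot y)$, $x\in X$, $\lambda\in\mathbb{R}\setminus\{0\}$. One has that $C_{\mathcal R}(\Omega)$ is the norm closure of $\bigcup_{\Lambda}\pi_\Lambda^*C_{\mathcal R}(\Omega_\Lambda)$ over finite $\Lambda\subset\Gamma$. Local dynamics: for finite $\Lambda\subset\Gamma$, $$H_\Lambda(p,q)=\sum_{k\in\Lambda}\Big(\frac{\|p_k\|^2}{2m_k}+\frac{\nu_k\|q_k\|^2}{2}\Big)+\sum_{k,l\in\Lambda}V_{kl}(q_k-q_l)$$ on $\Omega_\Lambda$, with (global) Hamiltonian flow $\Phi^t_{H_\Lambda}$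 solving $\frac{d}{dt}\Phi^t_{H_\Lambda}(p,q)=\big(-\nabla_qH_\Lambda,\nabla_pH_\Lambda\big)(\Phi^t_{H_\Lambda}(p,q))$, $\Phi^0_{H_\Lambda}=\mathrm{id}$; and $\alpha_\Lambda^t(f\circ\pi_\Lambda)=f\circ\Phi^t_{H_\Lambda}\circ\pi_\Lambda$ for $f\in C_{\mathcal R}(\Omega_\Lambda)$, which maps $\pi_\Lambda^*C_{\mathcal R}(\Omega_\Lambda)$ into itself. Infinite-volume dynamics: under conditions (i)-(iv), for each $t\in\mathbb{R}$, $\alpha^t$ is the unique $*$-automorphism of $C_{\mathcal R}(\Omega)$ such that $\alpha^t(f)=\lim_{\Lambda\nearrow\Gamma}\alpha^t_\Lambda(f)$ (sup-norm limit of the net of finite subsets $\Lambda\supseteq\Lambda_0$ ordered by inclusion) for all finite $\Lambda_0\subset\Gamma$ and $f\in\pi_{\Lambda_0}^*C_{\mathcal R}(\Omega_{\Lambda_0})$; these form a one-parameter group. Subalgebra $\mathfrak{K}$: $\mathfrak{K}=C^*(\mathfrak{K}_\Lambda\mid\Lambda\subset\Gamma\text{ finite})+\mathbb{C}1\subset C_{\mathcal R}(\Omega)$, where $\mathfrak{K}_\Lambda=\{g\circ\pi_\Lambda: g\in C_0(\Omega_\Lambda)\}$ and $C^*(\cdot)$ denotes the generated C*-subalgebra of $C_{\mathcal R}(\Omega)$. $\mathrm{Aut}(\mathfrak{L})$ is the group of $*$-automorphisms of $\mathfrak{L}$; strong continuity means that $t\mapsto\alpha^t(f)$ is norm continuous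 for each $f\in\mathfrak{L}$. *)

(* Defs.v *)
From HB Require Import structures.
From mathcomp Require Import all_boot all_order all_algebra finmap complex.
From mathcomp Require Import all_classical all_reals all_analysis.
From mathcomp Require Import ring.
From mathcomp Require showcase.summability.
Set Implicit Arguments.
Unset Strict Implicit.
Unset Printing Implicit Defensive.
Import Order.TTheory GRing.Theory Num.Theory.
Import numFieldNormedType.Exports.
Local Open Scope classical_set_scope.
Local Open Scope ring_scope.

(* The topology and norm that numFieldTypes carry, made available on [R[i]]. *)
HB.instance Definition _ (R : realType) := NormedModule.copy R[i] R[i]^o.

HB.mixin Record NormedModule_hasInner (R : realType) X & NormedModule R X := {
  inner : X -> X -> R;
  innerC : forall x y, inner x y = inner y x;
  innerDl : forall x y z, inner (x + y) z = inner x z + inner y z;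
  innerZl : forall a x y, inner (a *: x) y = a * inner x y;
  innerxx : forall x, inner x x = `|x| ^+ 2 }.

#[short(type="innerProductType")]
HB.structure Definition InnerProduct (R : realType) :=
  {X of NormedModule R X & NormedModule_hasInner R X}.

HB.factory Record Lmodule_hasInner (R : realType) X & GRing.Lmodule R X := {
  inner : X -> X -> R;
  innerC : forall x y, inner x y = inner y x;
  innerDl : forall x y z, inner (x + y) z = inner x z + inner y z;
  innerZl : forall a x y, inner (a *: x) y = a * inner x y;
  inner_gt0 : forall x, x != 0 -> 0 < inner x x }.

HB.builders Context R X & Lmodule_hasInner R X.

Let inner0l x : inner 0 x = 0.
Proof. by rewrite -(scale0r 0) innerZl mul0r. Qed.

Let inner_ge0 x : 0 <= inner x x.
Proof. by have [->|/inner_gt0/ltW//] := eqVneq x 0; rewrite inner0l. Qed.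

Definition inner_norm x := Num.sqrt (inner x x).

Let inner_norm_sqr x : inner x x = inner_norm x ^+ 2.
Proof. by rewrite sqr_sqrtr. Qed.

Let inner_sqrD a x y : inner (a *: x + y) (a *: x + y) =
  a ^+ 2 * inner x x + 2 * a * inner x y + inner y y.
Proof.
rewrite innerDl !innerZl ![inner _ (_ + _)]innerC !innerDl !innerZl.
rewrite (innerC y x); ring.
Qed.

Let CauchySchwarz x y : inner x y <= inner_norm x * inner_norm y.
Proof.
have [->|x0] := eqVneq x 0; first by rewrite inner0l mulr_ge0 ?sqrtr_ge0.
have xx := inner_gt0 x0.
rewrite /inner_norm -sqrtrM ?inner_ge0//.
apply: le_trans (ler_norm _) _.
rewrite -sqrtr_sqr ler_sqrt ?mulr_ge0 ?inner_ge0//.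
have := inner_ge0 ((- inner x y) *: x + inner x x *: y).
rewrite inner_sqrD innerZl ![inner _ (_ *: y)]innerC !innerZl (innerC y x).
set a := inner x x; set b := inner x y; set c := inner y y => h.
rewrite -subr_ge0 -(pmulr_rge0 _ xx) -/a.
by apply: le_trans h _; rewrite le_eqVlt; apply/orP; left; apply/eqP; ring.
Qed.

Let inner_normD x y : inner_norm (x + y) <= inner_norm x + inner_norm y.
Proof.
rewrite -(@ler_pXn2r _ 2) ?nnegrE ?addr_ge0 ?sqrtr_ge0//.
rewrite -inner_norm_sqr -[x in x + _]scale1r inner_sqrD sqrrD -!inner_norm_sqr.
rewrite expr1n mul1r mulr1 lerD2r lerD2l mulr_natl.
by rewrite lerMn2r CauchySchwarz orbT.
Qed.

Let inner_normZ a x : inner_norm (a *: x) = `|a| * inner_norm x.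
Proof.
rewrite /inner_norm innerZl innerC innerZl mulrA -expr2.
by rewrite sqrtrM ?sqr_ge0// sqrtr_sqr.
Qed.

Let inner_norm0_eq0 x : inner_norm x = 0 -> x = 0.
Proof.
move=> x0; apply/eqP/negPn/negP => /inner_gt0.
by rewrite inner_norm_sqr x0 expr0n/= ltxx.
Qed.

HB.instance Definition _ :=
  Lmodule_isNormed.Build R X inner_normD inner_normZ inner_norm0_eq0.

HB.instance Definition _ := NormedModule_hasInner.Build R X
  innerC innerDl innerZl inner_norm_sqr.

HB.end.

Definition Cb (R : realType) (X : topologicalType) : set (X -> R[i]) :=
  [set f | continuous f /\ bounded_fun f].
Arguments Cb R X : clear implicits.

Definition vanishes_at_infinity (K : numFieldType) (X : topologicalType)
    (V : normedModType K) (f : X -> V) : Prop :=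
  forall e : K, 0 < e ->
    exists2 B : set X, compact B & forall x, ~ B x -> `|f x| < e.

Definition C0 (R : realType) (X : topologicalType) : set (X -> R[i]) :=
  [set f | continuous f /\ vanishes_at_infinity f].
Arguments C0 R X : clear implicits.

Section Cstar.
Variables (R : realType) (X : topologicalType).
Implicit Types (A S : set (X -> R[i])) (f g : X -> R[i]).

(* C*-subalgebras of [Cb R X], not necessarily unital; on bounded functions the
   topology of [{uniform X -> R[i]}] is that of the sup-norm. *)
Record Cstar_subalgebra A : Prop := {
  Cstar_Cb : A `<=` Cb R X;
  Cstar0 : A (fun=> 0);
  CstarD : forall f g, A f -> A g -> A (fun x => f x + g x);
  CstarZ : forall c f, A f -> A (fun x => c * f x);
  CstarM : forall f g, A f -> A g -> A (fun x => f x * g x);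
  CstarJ : forall f, A f -> A (fun x => (f x)^*);
  Cstar_closed : closed (A : set {uniform X -> R[i]}) }.

Definition Cstar_gen S : set (X -> R[i]) := smallest Cstar_subalgebra S.

Record star_automorphism A (a : (X -> R[i]) -> (X -> R[i])) : Prop := {
  star_aut_bij : set_bij A A a;
  star_autD : forall f g, A f -> A g ->
    a (fun x => f x + g x) = (fun x => a f x + a g x);
  star_autZ : forall c f, A f -> a (fun x => c * f x) = (fun x => c * a f x);
  star_autM : forall f g, A f -> A g ->
    a (fun x => f x * g x) = (fun x => a f x * a g x);
  star_autJ : forall f, A f -> a (fun x => (f x)^*) = (fun x => (a f x)^*) }.

(* [alpha t] is given on all functions, but only its restriction to [A] is
   constrained. *)
Record Cstar_dynamical_system A
    (alpha : R -> (X -> R[i]) -> (X -> R[i])) : Prop := {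
  Cstar_dyn_alg : Cstar_subalgebra A;
  Cstar_dyn_aut : forall t, star_automorphism A (alpha t);
  Cstar_dyn0 : forall f, A f -> alpha 0 f = f;
  Cstar_dynD : forall s t f, A f -> alpha (s + t) f = alpha s (alpha t f);
  Cstar_dyn_continuous : forall f, A f ->
    continuous (fun t => alpha t f : {uniform X -> R[i]}) }.

End Cstar.

Definition resolvent_fun (R : realType) (X : innerProductType R) (x : X)
    (lam : R) : X -> R[i] :=
  fun y => ('i * lam%:C%C - (inner x y)%:C%C)^-1.

Definition CR (R : realType) (X : innerProductType R) : set (X -> R[i]) :=
  Cstar_gen [set h | exists x, exists2 lam, lam != 0 & h = resolvent_fun x lam].
Arguments CR {R} X.

Definition dotv (R : realType) (d : nat) (u v : 'rV[R]_d) : R :=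
  \sum_(j < d) u 0 j * v 0 j.

Section Phase.
Variables (R : realType) (d : nat) (G : choiceType).

Notation site := ('rV[R]_d * 'rV[R]_d)%type.

Definition fin_supp : {pred (G -> site)} :=
  fun x => `[< finite_set [set k | x k != 0] >].

Lemma fin_supp_submod_closed : submod_closed fin_supp.
Proof.
split=> [|a x y /asboolP fx /asboolP fy]; apply/asboolP.
  by rewrite (_ : [set _ | _] = set0)//; apply/seteqP; split=> k //=; rewrite eqxx.
apply: (@sub_finite_set _ _ ([set k | x k != 0] `|` [set k | y k != 0])).
  move=> k /=; case: (eqVneq (x k) 0) => [xk|]; last by left.
  case: (eqVneq (y k) 0) => [yk|]; last by right.
  by rewrite /= [X in X != 0](_ : _ = a *: x k + y k)// xk yk scaler0 addr0 eqxx.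
by rewrite finite_setU.
Qed.

HB.instance Definition _ :=
  GRing.isSubmodClosed.Build R (G -> site) fin_supp fin_supp_submod_closed.

(* [phase k] is the pair (p_k, q_k) *)
Record phase := Phase {
  phase_fun :> G -> site;
  phase_fin_supp : phase_fun \in fin_supp }.

HB.instance Definition _ := [isSub for phase_fun].
HB.instance Definition _ := [Choice of phase by <:].
HB.instance Definition _ := [SubChoice_isSubLmodule of phase by <:].

Definition momentum (x : phase) (k : G) : 'rV[R]_d := (x k).1.
Definition position (x : phase) (k : G) : 'rV[R]_d := (x k).2.

Definition phase_inner (x y : phase) : R := \sum_(k \in [set: G])
  (dotv (momentum x k) (momentum y k) + dotv (position x k) (position y k)).

Lemma dotvC (u v : 'rV[R]_d) : dotv u v = dotv v u.
Proof. by apply: eq_bigr => j _; rewrite mulrC. Qed.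

Lemma dotvDl (u v w : 'rV[R]_d) : dotv (u + v) w = dotv u w + dotv v w.
Proof. by rewrite -big_split/=; apply: eq_bigr => j _; rewrite mxE mulrDl. Qed.

Lemma dotvZl a (u v : 'rV[R]_d) : dotv (a *: u) v = a * dotv u v.
Proof. by rewrite mulr_sumr; apply: eq_bigr => j _; rewrite mxE mulrA. Qed.

Lemma dotv_ge0 (u : 'rV[R]_d) : 0 <= dotv u u.
Proof. by apply: sumr_ge0 => j _; rewrite -expr2 sqr_ge0. Qed.

Lemma dotv_eq0 (u : 'rV[R]_d) : dotv u u = 0 -> u = 0.
Proof.
move=> u0; apply/rowP => j; rewrite mxE; apply/eqP; rewrite -sqrf_eq0 expr2.
have /psumr_eq0P/(_ u0) -> // : forall i, true -> 0 <= u 0 i * u 0 i.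
by move=> i _; rewrite -expr2 sqr_ge0.
Qed.

Lemma dotv0l (u : 'rV[R]_d) : dotv 0 u = 0.
Proof. by rewrite -(scale0r 0) dotvZl mul0r. Qed.

Lemma phase_innerE (A : set G) (x y : phase) : finite_set A ->
  [set k | x k != 0] `<=` A -> phase_inner x y = \sum_(k <- fset_set A)
  (dotv (momentum x k) (momentum y k) + dotv (position x k) (position y k)).
Proof.
move=> fA xA; rewrite -fsbig_finite//; apply/esym/fsbig_widen => // k [_ nAk].
have /eqP xk0 : x k == 0 by apply: contra_notT nAk; exact: xA.
by rewrite /= /momentum /position xk0/= !dotv0l addr0.
Qed.

Let finite_suppU (x y : phase) :
  finite_set ([set k | x k != 0] `|` [set k | y k != 0]).
Proof.
by rewrite finite_setU; split; apply/asboolP;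
  [exact: (phase_fin_supp x)|exact: (phase_fin_supp y)].
Qed.

Let phase_innerC x y : phase_inner x y = phase_inner y x.
Proof. by apply: eq_fsbigr => k _; rewrite dotvC [X in _ + X]dotvC. Qed.

Let phase_innerDl x y z :
  phase_inner (x + y) z = phase_inner x z + phase_inner y z.
Proof.
rewrite !(@phase_innerE _ _ _ (finite_suppU x y)).
- by rewrite -big_split/=; apply: eq_bigr => k _; rewrite !dotvDl addrACA.
- by move=> k; right.
- by move=> k; left.
- move=> k /=; case: (eqVneq (x k) 0) => [xk|]; last by left.
  case: (eqVneq (y k) 0) => [yk|]; last by right.
  by rewrite [X in X != 0](_ : _ = x k + y k)// xk yk addr0 eqxx.
Qed.

Let phase_innerZl a x y : phase_inner (a *: x) y = a * phase_inner x y.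
Proof.
rewrite !(@phase_innerE _ _ _ (finite_suppU x x)).
- by rewrite mulr_sumr; apply: eq_bigr => k _; rewrite !dotvZl mulrDr.
- by move=> k; left.
- move=> k /=; case: (eqVneq (x k) 0) => [xk|]; last by left.
  by rewrite [X in X != 0](_ : _ = a *: x k)// xk scaler0 eqxx.
Qed.

Let phase_inner_gt0 x : x != 0 -> 0 < phase_inner x x.
Proof.
have term_ge0 k : 0 <= dotv (momentum x k) (momentum x k) +
    dotv (position x k) (position x k) by rewrite addr_ge0 ?dotv_ge0.
apply: contraNT; rewrite -leNgt => xx; apply/eqP/val_inj/funext => k /=.
apply: contra_leP xx => xk.
rewrite (@phase_innerE _ _ _ (finite_suppU x x)); last by move=> l; left.
rewrite (big_fsetD1 k)/=; last first.
  by rewrite in_fset_set// inE; left; apply/eqP.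
rewrite ltr_pwDl ?sumr_ge0// lt_neqAle term_ge0 andbT eq_sym.
rewrite paddr_eq0 ?dotv_ge0//; apply/negP => /andP[/eqP/dotv_eq0 p0 /eqP/dotv_eq0 q0].
by apply: xk; rewrite [x k]surjective_pairing; congr pair.
Qed.

HB.instance Definition _ := Lmodule_hasInner.Build R phase
  phase_innerC phase_innerDl phase_innerZl phase_inner_gt0.

Section Local.
Variable L : {fset G}.

Definition supported_in : {pred phase} :=
  fun x => `[< forall k, k \notin L -> x k = 0 >].

Lemma supported_in_submod_closed : submod_closed supported_in.
Proof.
split=> [|a x y /asboolP xL /asboolP yL]; apply/asboolP => k kL //.
by rewrite [LHS](_ : _ = a *: x k + y k)// xL// yL// scaler0 addr0.
Qed.

HB.instance Definition _ :=
  GRing.isSubmodClosed.Build R phase supported_in supported_in_submod_closed.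

Record local_phase := LocalPhase {
  phase_of_local :> phase;
  local_phaseP : phase_of_local \in supported_in }.

HB.instance Definition _ := [isSub for phase_of_local].
HB.instance Definition _ := [Choice of local_phase by <:].
HB.instance Definition _ := [SubChoice_isSubLmodule of local_phase by <:].

Let local_inner (x y : local_phase) : R := inner (val x) (val y).

Let local_innerC x y : local_inner x y = local_inner y x.
Proof. exact: innerC. Qed.

Let local_innerDl x y z :
  local_inner (x + y) z = local_inner x z + local_inner y z.
Proof. exact: innerDl. Qed.

Let local_innerZl a x y : local_inner (a *: x) y = a * local_inner x y.
Proof. exact: innerZl. Qed.

Let local_inner_gt0 x : x != 0 -> 0 < local_inner x x.
Proof. exact: phase_inner_gt0. Qed.

HB.instance Definition _ := Lmodule_hasInner.Build R local_phase
  local_innerC local_innerDl local_innerZl local_inner_gt0.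

Lemma truncate_fin_supp (F : G -> site) :
  (fun k => if k \in L then F k else 0) \in fin_supp.
Proof.
apply/asboolP; apply: (@sub_finite_set _ _ [set` L]) => // k /=.
by case: ifP => //; rewrite eqxx.
Qed.

Lemma truncate_supported (F : G -> site) :
  Phase (truncate_fin_supp F) \in supported_in.
Proof. by apply/asboolP => k /= /negPf ->. Qed.

Definition truncate (F : G -> site) : local_phase :=
  LocalPhase (truncate_supported F).

Definition phase_proj (x : phase) : local_phase := truncate x.

Lemma proj_orthogonal (x : phase) (y : local_phase) :
  inner (x - phase_proj x) (y : phase) = 0.
Proof.
rewrite innerC -[LHS]/(phase_inner _ _).
have yL : [set k | (y : phase) k != 0] `<=` [set` L].
  move=> k /= yk; apply: contraNT yk => kL.
  by have /asboolP -> := local_phaseP y.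
rewrite (phase_innerE _ _ yL)// big1_seq// => k /=.
rewrite in_fset_set// inE /= => kL.
have xk0 : (x - phase_proj x : phase) k = 0.
  by rewrite [LHS](_ : _ = x k - phase_proj x k)//= kL subrr.
by rewrite /momentum /position xk0/= ![dotv _ 0]dotvC !dotv0l addr0.
Qed.

Lemma projK (x : local_phase) : phase_proj x = x.
Proof.
apply/val_inj/val_inj/funext => k /=; case: ifPn => // kL.
by have /asboolP -> := local_phaseP x.
Qed.

End Local.
End Phase.

Arguments phase_proj {R d G} L x.

Section Dynamics.
Variables (R : realType) (d : nat) (G : choiceType).

Definition hamiltonian (m nu : G -> R) (V : G -> G -> 'rV[R]_d -> R)
    (L : {fset G}) (x : local_phase R d L) : R :=
  \sum_(k <- L) (dotv (momentum x k) (momentum x k) / (2 * m k)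
                 + nu k * dotv (position x k) (position x k) / 2)
  + \sum_(k <- L) \sum_(l <- L) V k l (position x k - position x l).

Section Flow.
Variables (L : {fset G}) (H : local_phase R d L -> R).

(* The directions of differentiation are the unit coordinate vectors of the
   components p_k and q_k, for k in L. *)
Definition grad_p (x : local_phase R d L) (k : G) : 'rV[R]_d :=
  \row_j 'D_(truncate L (fun l => if l == k then ('e_j, 0) else 0)) H x.

Definition grad_q (x : local_phase R d L) (k : G) : 'rV[R]_d :=
  \row_j 'D_(truncate L (fun l => if l == k then (0, 'e_j) else 0)) H x.

Definition hamiltonian_field (x : local_phase R d L) : local_phase R d L :=
  truncate L (fun k => (- grad_q x k, grad_p x k)).

Definition is_hamiltonian_flow (Phi : R -> local_phase R d L -> local_phase R d L)
    : Prop :=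
  forall x, Phi 0 x = x /\
    forall t : R, is_derive t 1 (Phi^~ x) (hamiltonian_field (Phi t x)).

End Flow.

Variable Phi : forall L : {fset G}, R -> local_phase R d L -> local_phase R d L.

(* Defined on all functions on the phase space; see [local_evolutionE] for the
   functions that only depend on the coordinates in [L]. *)
Definition local_evolution (L : {fset G}) (t : R) (f : phase R d G -> R[i]) :
    phase R d G -> R[i] :=
  fun x => f (Phi t (phase_proj L x)).

Lemma local_evolutionE (L : {fset G}) (t : R) (f : local_phase R d L -> R[i]) :
  local_evolution L t (f \o phase_proj L) = f \o Phi t \o phase_proj L.
Proof. by apply/funext => x; rewrite /local_evolution/= projK. Qed.

(* [totally] is the filter of the net of finite subsets ordered by inclusion;
   the evolved local observable is eventually the one of [local_evolutionE],
   since it factors through [phase_proj L] as soon as [L] contains [L0]. *)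
Definition is_infinite_volume_dynamics
    (alpha : R -> (phase R d G -> R[i]) -> (phase R d G -> R[i])) : Prop :=
  forall t : R, star_automorphism (CR (phase R d G)) (alpha t) /\
    forall (L0 : {fset G}) (f : local_phase R d L0 -> R[i]),
      CR (local_phase R d L0) f ->
      {uniform, (fun L => local_evolution L t (f \o phase_proj L0))
                  @ summability.totally --> alpha t (f \o phase_proj L0)}.

Definition frakK_loc (L : {fset G}) : set (phase R d G -> R[i]) :=
  [set g \o phase_proj L | g in C0 R (local_phase R d L)].

End Dynamics.

Definition frakK (R : realType) (d : nat) (G : choiceType) :
    set (phase R d G -> R[i]) :=
  [set f | exists2 g, Cstar_gen (\bigcup_(L in [set: {fset G}]) frakK_loc L) g &
           exists c : R[i], f = (fun x => g x + c)].
Arguments frakK R d G : clear implicits.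

Definition frakL (R : realType) (d : nat) (G : choiceType)
    (alpha : R -> (phase R d G -> R[i]) -> (phase R d G -> R[i])) :
    set (phase R d G -> R[i]) :=
  Cstar_gen (\bigcup_(t in [set: R]) (alpha t @` frakK R d G)).

Section PartialDerivatives.
Variables (R : realType) (d : nat).
Implicit Types f : 'rV[R]_d -> R.

Definition partial (j : 'I_d) f : 'rV[R]_d -> R := fun x => 'D_('e_j) f x.

Definition mpartial (beta : 'I_d -> nat) f : 'rV[R]_d -> R :=
  foldr (fun j => iter (beta j) (partial j)) f (enum 'I_d).

Definition smooth f : Prop := forall s : seq 'I_d,
  continuous (foldr partial f s) /\
  forall j x, derivable (foldr partial f s) x 'e_j.

End PartialDerivatives.

(* Main.v *)
(* By [alpha_dyn], the local evolutions converge to [alpha t] on local resolvents;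
   since *-automorphisms are contractive, the convergence extends to all of
   C_R(Omega), and the group law of [alpha] follows from that of the
   finite-volume Hamiltonian flows, which is uniqueness for an ODE with a locally
   Lipschitz field.

   Strong continuity holds on a C*-subalgebra that is invariant under the
   evolution, so it suffices to check it at t = 0 for g o pi_Lambda with g in
   C_0(Omega_Lambda).  There, Gronwall's inequality applied at each site of Lambda
   bounds the displacement during the time t by c |t| (1 + |x|^2), where the force
   is bounded by condition (iii), so that c does not depend on the volume.  Since
   the flow is reversible, |x| may be replaced by the norm at either end of the
   trajectory, and outside of a compact set g is small anyway.

   C_0(Omega_Lambda) lies in C_R(Omega_Lambda) by a quantitative form of the
   Stone-Weierstrass theorem: with h_i the resolvents of the coordinates, the
   functions 1 - sum_i |h_i - h_i(a)|^2 / n, raised to a high power and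
   normalized, form a partition of unity that is concentrated near the points a
   of a finite net. *)
Require Import Defs.
From HB Require Import structures.
From mathcomp Require Import all_boot all_order all_algebra finmap complex.
From mathcomp Require Import all_classical all_reals all_analysis.
From mathcomp Require Import ring lra.
From mathcomp Require showcase.summability.
Import Order.TTheory GRing.Theory Num.Theory.
Import numFieldNormedType.Exports.
Local Open Scope classical_set_scope.
Local Open Scope ring_scope.
Set Implicit Arguments.
Unset Strict Implicit.
Unset Printing Implicit Defensive.

(** * Uniform convergence and C*-algebras of functions *)

Section UniformLimits.
Variables (R : realType) (X : topologicalType).
Implicit Types (f g : X -> R[i]) (A S : set (X -> R[i])).

(** Radii live in [R[i]] because [R[i]] is normed over itself. The order of [R[i]] makes every
    positive radius real, see [gt0_complex]. *)
Lemma near_uniformP f (P : set (X -> R[i])) :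
  nbhs (f : {uniform X -> R[i]}) P <->
  exists2 e : R[i], 0 < e & forall g, (forall x, `|f x - g x| < e) -> P g.
Proof.
split.
  move=> /uniform_nbhs[E [+ EP]].
  rewrite -entourage_ballE => -[e /= e0 eE]; exists e => // g fg.
  by apply: EP => y _; apply: eE; exact: fg.
move=> [e e0 eP]; apply/uniform_nbhs.
exists [set xy | ball xy.1 e xy.2]; split; first exact: (entourage_ball _ (PosNum e0)).
by move=> g /= fg; apply: eP => x; exact: fg.
Qed.

Lemma cvg_uniformP (T : Type) (F : set_system T) (FF : Filter F)
    (u : T -> X -> R[i]) f :
  {uniform, u @ F --> f} <->
  forall e : R[i], 0 < e -> \forall t \near F, forall x, `|f x - u t x| < e.
Proof.
split=> [uf e e0|uf P].
  by apply: (uf [set g | forall x, `|f x - g x| < e]); apply/near_uniformP; exists e.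
move=> /near_uniformP[e e0 eP].
by apply: filterS (uf e e0) => t; exact: eP.
Qed.

Lemma closed_uniformP A : closed (A : set {uniform X -> R[i]}) <->
  forall f, (forall e : R[i], 0 < e -> exists2 g, A g & forall x, `|f x - g x| < e) ->
  A f.
Proof.
split=> cA f fA.
  apply: cA => P /near_uniformP[e e0 eP].
  by have [g Ag fg] := fA _ e0; exists g; split => //; exact: eP.
apply: cA => e e0.
have [g [Ag fg]] : A `&` [set g | forall x, `|f x - g x| < e] !=set0.
  by apply: fA; apply/near_uniformP; exists e.
by exists g.
Qed.

Lemma bounded_funP f :
  bounded_fun f <-> exists2 M : R, 0 < M & forall x, `|f x| <= M%:C%C.
Proof.
split=> [[M [Mr fM]]|[M M0 fM]].
  (* [bounded_fun] only gives a bound by every number strictly above [M], hence the shift by one. *)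
  exists (`|complex.Re M| + 1) => [|x]; first by rewrite ltr_wpDl.
  apply: fM => //; rewrite -(RRe_real Mr) ltcR.
  by rewrite (le_lt_trans (ler_norm _))// ltrDl.
exists M%:C%C; split; first by rewrite complex_real.
by move=> N MN x _; apply: le_trans (fM x) (ltW MN).
Qed.

End UniformLimits.

(** * Real elements and conjugation in the complex numbers *)

Section Conj.
Variable R : realType.

Lemma normC_complex (z : R[i]) : exists2 r : R, 0 <= r & `|z| = r%:C%C.
Proof. by rewrite normc_def; eexists; [|reflexivity]; exact: sqrtr_ge0. Qed.

Lemma gt0_complex (z : R[i]) : 0 < z -> exists2 r : R, 0 < r & z = r%:C%C.
Proof.
move=> z0; have zr : (complex.Re z)%:C%C = z by rewrite RRe_real// gtr0_real.
by exists (complex.Re z); rewrite ?zr// -ltcR zr.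
Qed.

Lemma normC_real (r : R) : `|r%:C%C| = `|r|%:C%C.
Proof. by rewrite normc_def/= expr0n addr0 sqrtr_sqr. Qed.

Lemma continuous_conjC : continuous (fun z : R[i] => z^*).
Proof.
move=> z; apply/(@cvgrPdist_lt _ R[i] R[i] (nbhs z)) => e e0; near=> w.
rewrite -rmorphB norm_conjC; near: w.
exact: (nbhsx_ballx z e e0).
Unshelve. all: by end_near. Qed.

Lemma continuous_complex : continuous (fun r : R => r%:C%C).
Proof.
move=> r; apply/cvgrPdist_lt => e e0.
have [d d0 ->] := gt0_complex e0.
near=> s; rewrite -rmorphB normC_real ltcR.
near: s; exact: (nbhsx_ballx r d d0).
Unshelve. all: by end_near. Qed.

End Conj.

(** * Generated C*-subalgebras *)

Section CstarSubalgebra.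
Variables (R : realType) (X : topologicalType).
Implicit Types (f g : X -> R[i]) (A S : set (X -> R[i])).

(** Closedness is the stability of continuity under uniform limits, by the usual splitting of [e]
    into thirds. *)
Lemma Cstar_subalgebra_Cb : Cstar_subalgebra (Cb R X).
Proof.
split.
- by [].
- by split; [move=> x; exact: cvg_cst|apply/bounded_funP; exists 1 => // x; rewrite normr0 ler01].
- move=> f g [cf /bounded_funP[M M0 fM]] [cg /bounded_funP[N N0 gN]]; split.
    by move=> x; apply: cvgD; [exact: cf|exact: cg].
  apply/bounded_funP; exists (M + N) => [|x]; first exact: addr_gt0.
  by rewrite rmorphD (le_trans (ler_normD _ _))// lerD.
- move=> c f [cf /bounded_funP[M M0 fM]]; split.
    by move=> x; apply: cvgM; [exact: cvg_cst|exact: cf].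
  have [r r0 cr] := normC_complex c.
  apply/bounded_funP; exists ((r + 1) * M) => [|x].
    by rewrite mulr_gt0// ltr_wpDl.
  by rewrite normrM rmorphM ler_pM// cr lecR lerDl.
- move=> f g [cf /bounded_funP[M M0 fM]] [cg /bounded_funP[N N0 gN]]; split.
    by move=> x; apply: cvgM; [exact: cf|exact: cg].
  apply/bounded_funP; exists (M * N) => [|x]; first exact: mulr_gt0.
  by rewrite rmorphM normrM ler_pM.
- move=> f [cf /bounded_funP[M M0 fM]]; split.
    move=> x; apply: (@cvg_comp _ _ _ f (fun z : R[i] => z^*)); first exact: cf.
    exact: continuous_conjC.
  by apply/bounded_funP; exists M => // x; rewrite norm_conjC.
- apply/closed_uniformP => f fA; split; last first.
    have [g [_ /bounded_funP[M M0 gM]] fg] := fA 1 ltr01.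
    apply/bounded_funP; exists (1 + M) => [|x]; first exact: addr_gt0.
    rewrite -(subrK (g x) (f x)) rmorphD (le_trans (ler_normD _ _))// lerD//.
    exact: ltW.
  move=> x; apply/cvgrPdist_lt => e e0.
  have e3 : 0 < e / 3%:R by rewrite divr_gt0.
  have [g [cg _] fg] := fA _ e3.
  near=> y.
  have -> : f x - f y = (f x - g x) + ((g x - g y) + (g y - f y)) by ring.
  have -> : e = e / 3%:R + (e / 3%:R + e / 3%:R) by rewrite -!mulrDl; field.
  rewrite (le_lt_trans (ler_normD _ _))// ltrD//.
  rewrite (le_lt_trans (ler_normD _ _))// ltrD//; last by rewrite distrC.
  near: y.
  by have /cvgrPdist_lt/(_ _ e3) := cg x.
Unshelve. all: by end_near. Qed.

Lemma Cstar_gen_sub S A : Cstar_subalgebra A -> S `<=` A -> Cstar_gen S `<=` A.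
Proof. by move=> cA SA f; apply. Qed.

Lemma sub_Cstar_gen S : S `<=` Cstar_gen S.
Proof. by move=> f Sf A [_]; apply. Qed.

(** All closure properties pass to intersections. The hypothesis makes [Cb] one of the intersected
    algebras, which gives continuity and boundedness. *)
Lemma Cstar_subalgebra_gen S : S `<=` Cb R X -> Cstar_subalgebra (Cstar_gen S).
Proof.
move=> SC; split.
- by apply: Cstar_gen_sub => //; exact: Cstar_subalgebra_Cb.
- by move=> A [cA SA]; exact: Cstar0.
- by move=> f g Sf Sg A /[dup] AA [cA SA]; apply: CstarD; [|exact: Sf|exact: Sg].
- by move=> c f Sf A /[dup] AA [cA SA]; apply: CstarZ => //; exact: Sf.
- by move=> f g Sf Sg A /[dup] AA [cA SA]; apply: CstarM; [|exact: Sf|exact: Sg].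
- by move=> f Sf A /[dup] AA [cA SA]; apply: CstarJ => //; exact: Sf.
- apply/closed_uniformP => f fS A /[dup] AA [cA SA].
  have /closed_uniformP := Cstar_closed cA; apply => e /fS[g Sg fg].
  by exists g => //; exact: Sg.
Qed.

End CstarSubalgebra.

(** * Inner product spaces and resolvent functions *)

Section InnerProduct.
Variables (R : realType) (X : innerProductType R).
Implicit Types x y z : X.

Lemma innerDr x y z : inner x (y + z) = inner x y + inner x z.
Proof. by rewrite innerC innerDl !(innerC x). Qed.

Lemma innerZr a x y : inner x (a *: y) = a * inner x y.
Proof. by rewrite innerC innerZl (innerC x). Qed.

Lemma innerNr x y : inner x (- y) = - inner x y.
Proof. by rewrite -scaleN1r innerZr mulN1r. Qed.

Lemma innerBr x y z : inner x (y - z) = inner x y - inner x z.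
Proof. by rewrite innerDr innerNr. Qed.

Lemma inner0r x : inner x 0 = 0.
Proof. by rewrite -(scale0r 0) innerZr mul0r. Qed.

Lemma inner_sumr x (I : Type) (s : seq I) (P : pred I) (F : I -> X) :
  inner x (\sum_(i <- s | P i) F i) = \sum_(i <- s | P i) inner x (F i).
Proof. by apply: (big_morph (inner x) (innerDr x) (inner0r x)). Qed.

(** Cauchy-Schwarz is read off from the square of the triangle inequality, applied to [y] and to
    [- y]. *)
Lemma inner_le x y : `|inner x y| <= `|x| * `|y|.
Proof.
have le (u v : X) : inner u v <= `|u| * `|v|.
  have : `|u + v| ^+ 2 <= (`|u| + `|v|) ^+ 2.
    by rewrite ler_pXn2r ?nnegrE ?addr_ge0// ler_normD.
  rewrite -innerxx innerDl !innerDr !innerxx (innerC v u); nra.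
have := le x y; have := le x (- y); rewrite innerNr normrN => h1 h2.
by rewrite ler_norml h2 andbT; lra.
Qed.

Lemma inner_continuous x : continuous (inner x).
Proof.
move=> y; apply/cvgrPdist_lt => e e0.
have x1 : 0 < `|x| + 1 by rewrite ltr_wpDl.
have e1 := divr_gt0 e0 x1.
near=> z; rewrite -innerBr (le_lt_trans (inner_le _ _))//.
apply: (@le_lt_trans _ _ ((`|x| + 1) * `|y - z|)).
  by rewrite ler_wpM2r// lerDl.
rewrite mulrC -(ltr_pdivlMr _ _ x1).
near: z; exact: (@cvgr_dist_lt _ _ _ _ _ id y cvg_id _ e1).
Unshelve. all: by end_near. Qed.

Lemma resolvent_denom_neq0 (lam r : R) : lam != 0 -> 'i * lam%:C%C - r%:C%C != 0 :> R[i].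
Proof.
move=> l0; apply: contraNN l0; rewrite -complexiE => /eqP.
by move=> /eqP; rewrite eq_complex/= => /andP[_]; rewrite !(mul0r,mul1r,mulr0,add0r,oppr0,addr0).
Qed.

(** The denominator has imaginary part [lam], so its modulus is at least that of [lam]. *)
Lemma resolvent_norm (lam r : R) : lam != 0 ->
  `|('i * lam%:C%C - r%:C%C)^-1 : R[i]| <= (`|lam|^-1)%:C%C.
Proof.
move=> l0; set z := _ - _.
have z0 : `|z| \is Num.pos by rewrite posrE normr_gt0 resolvent_denom_neq0.
have p0 : `|lam|%:C%C \is @Num.pos R[i] by rewrite posrE ltcR normr_gt0.
rewrite normfV [leRHS]fmorphV lef_pV2//.
rewrite normc_def lecR -sqrtr_sqr ler_sqrt ?addr_ge0 ?sqr_ge0//.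
rewrite /z -complexiE/= !(mul0r,mul1r,mulr0,add0r,oppr0,addr0,sub0r).
by rewrite lerDr sqr_ge0.
Qed.

Lemma resolvent_Cb x lam : lam != 0 -> Cb R X (resolvent_fun x lam).
Proof.
move=> l0; split; last first.
  apply/bounded_funP; exists `|lam|^-1 => [|y]; first by rewrite invr_gt0 normr_gt0.
  exact: resolvent_norm.
move=> y; apply: cvgV; first exact: resolvent_denom_neq0.
apply: cvgB; first exact: cvg_cst.
apply: (@cvg_comp _ _ _ (inner x) (fun r : R => r%:C%C)); first exact: inner_continuous.
exact: continuous_complex.
Qed.

Lemma Cstar_subalgebra_CR : Cstar_subalgebra (CR X).
Proof.
by apply: Cstar_subalgebra_gen => h [x [lam l0 ->]]; exact: resolvent_Cb.
Qed.

Lemma CR_resolvent x lam : lam != 0 -> CR X (resolvent_fun x lam).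
Proof. by move=> l0; apply: sub_Cstar_gen; exists x, lam. Qed.

(** The resolvent of the zero vector is the constant [1 / 'i], so the algebra is unital. *)
Lemma CR_cst c : CR X (fun=> c).
Proof.
have -> : (fun=> c) = (fun y : X => (c * 'i) * resolvent_fun 0 1 y).
  apply/funext => y; rewrite /resolvent_fun innerC inner0r subr0 mulr1.
  by rewrite mulfK ?neq0Ci.
by apply: (CstarZ Cstar_subalgebra_CR); exact: CR_resolvent (oner_neq0 _).
Qed.

End InnerProduct.

(** * Inverses in unital C*-algebras and contractivity of automorphisms *)

Section CstarAlgebra.
Variables (R : realType) (X : topologicalType) (A : set (X -> R[i])).
Hypothesis (AA : Cstar_subalgebra A).
Implicit Types (f g : X -> R[i]).

Lemma CstarN f : A f -> A (fun x => - f x).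
Proof.
by move=> Af; rewrite (_ : (fun _ => _) = fun x => -1 * f x);
  [exact: (CstarZ AA)|apply/funext => x; rewrite mulN1r].
Qed.

Lemma CstarB f g : A f -> A g -> A (fun x => f x - g x).
Proof. by move=> Af Ag; apply: (CstarD AA Af); exact: CstarN. Qed.

Lemma Cstar_sum (I : Type) (s : seq I) (F : I -> X -> R[i]) :
  (forall i, A (F i)) -> A (fun x => \sum_(i <- s) F i x).
Proof.
move=> AF; elim: s => [|i s IH].
  rewrite (_ : (fun _ => _) = fun=> 0); first exact: Cstar0.
  by apply/funext => x; rewrite big_nil.
rewrite (_ : (fun _ => _) = fun x => F i x + \sum_(j <- s) F j x).
  exact: (CstarD AA).
by apply/funext => x; rewrite big_cons.
Qed.

Hypothesis A1 : A (fun=> 1).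

Lemma CstarX f n : A f -> A (fun x => f x ^+ n).
Proof.
move=> Af; elim: n => [|n IH]; first exact: A1.
rewrite (_ : (fun _ => _) = fun x => f x * f x ^+ n).
  exact: (CstarM AA).
by apply/funext => x; rewrite exprS.
Qed.

(* The inverse is the sum of the Neumann series [\sum_n (1 - f)^n]. *)
Lemma CstarV f (q : R) : q < 1 -> (forall x, `|1 - f x| <= q%:C%C) ->
  A f -> A (fun x => (f x)^-1).
Proof.
move=> q1 fq Af.
(* On an empty domain all functions coincide; otherwise a point of [X] shows [0 <= q]. *)
have [x0|nX] := pselect (exists x : X, True); last first.
  by rewrite (_ : (fun _ => _) = f)//; apply/funext => x; exfalso; apply: nX; exists x.
have q0 : 0 <= q by case: x0 => x _; rewrite -ler0c (le_trans _ (fq x)).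
have q1' : 0 < 1 - q by rewrite subr_gt0.
have /closed_uniformP := Cstar_closed AA; apply => e /gt0_complex[d d0 ->].
(* The remainder of the series is [(1 - f) ^+ N / f], and [f] has modulus at least [1 - q]; so
   [q ^+ N < d * (1 - q)] suffices. *)
have /cvgrPdist_lt/(_ (d * (1 - q)) (mulr_gt0 d0 q1'))[N _ /(_ N (leqnn N))] :=
  @cvg_expr R q (ltac:(by rewrite ger0_norm)).
rewrite sub0r normrN ger0_norm ?exprn_ge0// => qN.
exists (fun x => \sum_(i <- index_iota 0 N) (1 - f x) ^+ i).
  apply: Cstar_sum => i; apply: CstarX; apply: CstarB => //; exact: A1.
move=> x.
have f1 : (1 - q)%:C%C <= `|f x|.
  rewrite rmorphB; have := ler_normD (1 - f x) (f x); rewrite subrK normr1 => h.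
  by rewrite lerBlDl (le_trans h)// lerD2r.
have fx0 : f x != 0 by rewrite -normr_gt0 (lt_le_trans _ f1)// ltcR.
have -> : (f x)^-1 - \sum_(i <- index_iota 0 N) (1 - f x) ^+ i = (f x)^-1 * (1 - f x) ^+ N.
  apply: (mulfI fx0); rewrite mulrBr mulrA divff// mul1r big_mkord.
  have := subrX1 (1 - f x) N => h.
  rewrite (_ : (1 - f x) - 1 = - f x) in h; last by ring.
  by rewrite mulNr in h; rewrite -[f x * _]opprK -h; ring.
rewrite normrM normfV mulrC ltr_pdivrMr ?normr_gt0// normrX.
apply: (@le_lt_trans _ _ ((q ^+ N)%:C%C)).
  by rewrite rmorphXn lerXn2r// nnegrE// ler0c.
apply: (@lt_le_trans _ _ ((d * (1 - q))%:C%C)); first by rewrite ltcR.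
by rewrite rmorphM ler_pM2l// ltcR.
Qed.

(** By surjectivity 1 is the image of some [u], and the image of [1 * u] is that of [u]. *)
Lemma star_automorphism1 a : star_automorphism A a -> a (fun=> 1) = fun=> 1.
Proof.
move=> aA; have [_ _ asurj] := star_aut_bij aA.
have [u Au au] := asurj _ A1.
have := star_autM aA A1 Au.
rewrite (_ : (fun x => 1 * u x) = u); last by apply/funext => x; rewrite mul1r.
rewrite au => h; apply/funext => x; move/(congr1 (fun f => f x)) : h.
by rewrite mulr1.
Qed.

(* If [|a f x|] exceeded [c], then [1 - f / a f x] would be invertible in [A],
   although its image under [a] vanishes at [x]. *)
Lemma star_automorphism_le a f (c : R[i]) : star_automorphism A a -> A f -> 0 <= c ->
  (forall x, `|f x| <= c) -> forall x, `|a f x| <= c.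
Proof.
move=> aA Af c0 fc x; have [//|] := real_leP (normr_real (a f x)) (ger0_real c0).
set l := a f x => cl.
have l0 : `|l| > 0 by exact: le_lt_trans c0 cl.
have l0' : l != 0 by rewrite -normr_gt0.
have Alf : A (fun y => - l^-1 * f y) by exact: (CstarZ AA).
have AF : A (fun y => 1 + (- l^-1 * f y)) by apply: (CstarD AA) => //; exact: A1.
have cl0 : 0 <= c / `|l| by rewrite divr_ge0.
have cl1 : c / `|l| < 1 by rewrite ltr_pdivrMr// mul1r.
have [q q0 qE] := normC_complex (c / `|l|); rewrite ger0_norm// in qE.
have q1 : q < 1 by rewrite -ltcR -qE.
have fq y : `|1 - (1 + (- l^-1 * f y))| <= q%:C%C.
  rewrite opprD addrA subrr sub0r mulNr opprK normrM normfV mulrC -qE.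
  by rewrite ler_pM2r ?invr_gt0.
have AV := CstarV q1 fq AF.
have := star_autM aA AF AV.
have -> : (fun y => (1 + - l^-1 * f y) * (1 + - l^-1 * f y)^-1) = fun=> 1.
  apply/funext => y; rewrite divff//; apply: contraTneq q1 => F0.
  by have := fq y; rewrite F0 subr0 normr1 -leNgt lecR.
rewrite star_automorphism1// (star_autD aA A1 Alf) star_automorphism1// (star_autZ aA)//.
move=> /(congr1 (fun f => f x))/=; rewrite -/l mulNr mulVf// subrr mul0r.
by move/eqP; rewrite oner_eq0.
Qed.

End CstarAlgebra.

(** * Functions vanishing at infinity belong to the resolvent algebra *)

Section PartitionOfUnity.
Variables (R : realType) (X : topologicalType) (A : set (X -> R[i])).
Hypothesis (AA : Cstar_subalgebra A) (A1 : A (fun=> 1)).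

(* The powers [b j x ^+ N] are weights that concentrate, as [N] grows, on the
   [j] with [b j x > c2]. *)
Lemma Cstar_weights (J : finType) (b : J -> X -> R) (z : J -> R[i])
    (g : X -> R[i]) (c1 c2 M : R) (e : R[i]) :
  (forall j, A (fun x => (b j x)%:C%C)) ->
  0 <= c2 -> c2 < c1 -> 0 < M -> 0 < e ->
  (forall j x, 0 <= b j x <= 1) ->
  (forall x, exists j, c1 <= b j x) ->
  (forall j x, `|g x - z j| <= M%:C%C) ->
  (forall j x, c2 < b j x -> `|g x - z j| < e) ->
  exists2 h, A h & forall x, `|g x - h x| < e + e.
Proof.
move=> Ab c20 c21 M0 e0 b01 bc1 gM ge.
have [x0|nX] := pselect (exists x : X, True); last first.
  by exists (fun=> 0) => [|x]; [exact: Cstar0|exfalso; apply: nX; exists x].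
have c10 : 0 < c1 by exact: le_lt_trans c20 c21.
set m := #|J|%:R : R.
have m0 : 0 < m.
  by case: x0 => x _; have [j _] := bc1 x; rewrite ltr0n; apply/card_gt0P; exists j.
have [d d0 eE] := gt0_complex e0.
have r1 : `|c2 / c1| < 1.
  by rewrite ger0_norm ?divr_ge0// ?ltW// ltr_pdivrMr// mul1r.
have dm : 0 < d / (M * m) by rewrite divr_gt0// mulr_gt0.
(* [N] is such that the [m] light weights, each at most [c2 ^+ N], contribute together less than
   [d * c1 ^+ N], while the total weight [W] is at least [c1 ^+ N]. *)
have /cvgrPdist_lt/(_ _ dm)[N _ /(_ N (leqnn N))] := cvg_expr r1.
rewrite sub0r normrN ger0_norm ?exprn_ge0 ?divr_ge0 ?(ltW c10)// => rN.
pose W x := \sum_j b j x ^+ N.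
have Wge x : c1 ^+ N <= W x.
  have [j cj] := bc1 x; rewrite /W (bigD1 j)//= -[leLHS]addr0 lerD//.
    by rewrite lerXn2r ?nnegrE ?(ltW c10)//; have /andP[] := b01 j x.
  by apply: sumr_ge0 => i _; rewrite exprn_ge0//; have /andP[] := b01 i x.
have Wle x : W x <= m.
  apply: (@le_trans _ _ (\sum_(j : J) 1)); last by rewrite sumr_const.
  by apply: ler_sum => j _; rewrite exprn_ile1//; have /andP[] := b01 j x.
have c1N : 0 < c1 ^+ N by rewrite exprn_gt0.
have W0 x : 0 < W x by exact: lt_le_trans (Wge x).
have Aw j : A (fun x => (b j x)%:C%C ^+ N) by exact: CstarX.
(* Division by [m] brings the total weight into []0, 1]], at distance at most [1 - c1 ^+ N / m < 1]
   from 1, so that [CstarV] inverts it. *)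
have AW : A (fun x => m^-1%:C%C * (W x)%:C%C).
  apply: (CstarZ AA); rewrite (_ : (fun _ => _) = fun x => \sum_j (b j x)%:C%C ^+ N).
    exact: Cstar_sum.
  by apply/funext => x; rewrite rmorph_sum; apply: eq_bigr => j _; rewrite rmorphXn.
have q1 : 1 - c1 ^+ N / m < 1 by rewrite ltrBlDr ltrDl divr_gt0.
have Wq x : `|1 - m^-1%:C%C * (W x)%:C%C : R[i]| <= (1 - c1 ^+ N / m)%:C%C.
  rewrite -[in leLHS]rmorphM -(rmorph1 (real_complex R)) -rmorphB normC_real lecR.
  rewrite ger0_norm ?subr_ge0; last by rewrite mulrC ler_pdivrMr// mul1r.
  by rewrite lerD2l lerN2 mulrC ler_pM2l// invr_gt0.
have AV := CstarV AA A1 q1 Wq AW.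
exists (fun x => (\sum_j z j * (b j x)%:C%C ^+ N) *
    (m^-1%:C%C * (m^-1%:C%C * (W x)%:C%C)^-1)).
  apply: (CstarM AA); last exact: (CstarZ AA).
  by apply: Cstar_sum => // j; apply: (CstarZ AA).
move=> x; have mC : (m^-1%:C%C : R[i]) != 0.
  by rewrite eq_complex/= negb_and invr_eq0 gt_eqF.
have WC : ((W x)%:C%C : R[i]) != 0 by rewrite eq_complex/= negb_and gt_eqF.
rewrite invfM [m^-1%:C%C * _]mulrA divff// mul1r.
rewrite -[X in X - _](mulfK WC) -mulrBl normrM normfV.
have WC0 : `|(W x)%:C%C| = (W x)%:C%C :> R[i] by rewrite normC_real gtr0_norm.
rewrite WC0 ltr_pdivrMr ?ltcR//.
have -> : g x * (W x)%:C%C - \sum_j z j * (b j x)%:C%C ^+ N =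
    \sum_j (g x - z j) * (b j x)%:C%C ^+ N.
  rewrite rmorph_sum mulr_sumr -sumrB; apply: eq_bigr => j _.
  by rewrite mulrBl rmorphXn.
(* An index with [b j x > c2] is charged to the first summand, any other index to the second. *)
apply: (@le_lt_trans _ _ (\sum_j (e * (b j x ^+ N)%:C%C + (M * c2 ^+ N)%:C%C))).
  apply: (le_trans (ler_norm_sum _ _ _)); apply: ler_sum => j _.
  have /andP[b0 b1] := b01 j x.
  rewrite normrM -rmorphXn normC_real (ger0_norm (exprn_ge0 N b0)).
  have [bc|cb] := leP (b j x) c2.
    rewrite -[leLHS]add0r lerD//.
      by rewrite mulr_ge0 ?ler0c ?exprn_ge0// ltW.
    by rewrite rmorphM/=; apply: ler_pM => //; rewrite ?ler0c ?lecR ?exprn_ge0// lerXn2r ?nnegrE.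
  rewrite -[leLHS]addr0 lerD ?ler0c//; last by rewrite mulr_ge0 ?exprn_ge0// ltW.
  by rewrite ler_wpM2r ?ler0c ?exprn_ge0// ltW// ge.
rewrite big_split/= -mulr_sumr -rmorph_sum/= sumr_const mulrDl ltrD2l.
rewrite eE -!rmorphM -rmorphMn/= ltcR -mulr_natr -/m.
apply: (@lt_le_trans _ _ (d * c1 ^+ N)); last by rewrite ler_pM2l.
rewrite expr_div_n ltr_pdivrMr// mulrAC ltr_pdivlMr ?mulr_gt0// in rN.
by rewrite mulrAC mulrC.
Qed.

End PartitionOfUnity.

(** * The chordal distance on the real line *)

Section Chordal.
Variable R : realType.
Implicit Types x a r d : R.

(* A quarter of the squared distance of the stereographic projections. *)
Definition chord x a : R := (x - a) ^+ 2 / ((1 + x ^+ 2) * (1 + a ^+ 2)).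

Let pos x : 0 < 1 + x ^+ 2. Proof. by rewrite ltr_wpDr ?sqr_ge0. Qed.

Lemma chord_ge0 x a : 0 <= chord x a.
Proof. by rewrite divr_ge0 ?sqr_ge0// mulr_ge0// ltW. Qed.

(** The denominator equals [(x - a) ^+ 2 + (1 + x * a) ^+ 2]. *)
Lemma chord_le1 x a : chord x a <= 1.
Proof. by rewrite ler_pdivrMr ?mulr_gt0// mul1r; have := sqr_ge0 (1 + x * a); nra. Qed.

(** Only [x] is bounded. With [s = (x - a) ^+ 2], the bound [a ^+ 2 <= 2 * x ^+ 2 + 2 * s] makes the
    denominator at most [K * (K + 2 * s)]. The first term of the minimum then forces [s < K / 2],
    after which the second one gives [s < d ^+ 2]. *)
Lemma chord_dist r d : 0 < d -> exists2 eta, 0 < eta & forall x a,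
  `|x| <= r -> chord x a < eta -> `|x - a| < d.
Proof.
move=> d0; set K := 1 + 2 * r ^+ 2.
have r2 := sqr_ge0 r.
have K1 : 1 <= K by rewrite /K; lra.
have K0 : 0 < K by lra.
exists (Num.min (1 / (4 * K)) (d ^+ 2 / (2 * K ^+ 2))).
  by rewrite lt_min !divr_gt0// ?mulr_gt0// exprn_gt0.
move=> x a xr; rewrite lt_min => /andP[].
rewrite /chord !ltr_pdivrMr ?mulr_gt0//.
have x2 : x ^+ 2 <= r ^+ 2 by rewrite -real_normK ?num_real// lerXn2r ?nnegrE// (le_trans _ xr).
have a2 : a ^+ 2 <= 2 * x ^+ 2 + 2 * (x - a) ^+ 2.
  rewrite -subr_ge0 (_ : _ - _ = (2 * x - a) ^+ 2) ?sqr_ge0//; ring.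
set s := (x - a) ^+ 2 in a2 *.
have s0 : 0 <= s := sqr_ge0 _.
have P : (1 + x ^+ 2) * (1 + a ^+ 2) <= K * (K + 2 * s).
  by apply: ler_pM; [exact: ltW|exact: ltW|rewrite /K; lra|rewrite /K; lra].
move=> h1 h2.
have h1' : s < 1 / (4 * K) * (K * (K + 2 * s)).
  by apply: lt_le_trans h1 _; rewrite ler_pM2l// divr_gt0// mulr_gt0.
have h2' : s < d ^+ 2 / (2 * K ^+ 2) * (K * (K + 2 * s)).
  by apply: lt_le_trans h2 _; rewrite ler_pM2l// !divr_gt0// ?mulr_gt0// exprn_gt0.
rewrite (_ : 1 / (4 * K) * (K * (K + 2 * s)) = K / 4 + s / 2) in h1'; last by field; rewrite gt_eqF.
have sK : s < K / 2 by lra.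
have : s < d ^+ 2.
  apply: lt_le_trans h2' _.
  rewrite (_ : _ / _ * _ = d ^+ 2 * ((K + 2 * s) / (2 * K))); last by field; rewrite gt_eqF.
  by rewrite ger_pMr ?exprn_gt0// ler_pdivrMr ?mulr_gt0//; lra.
by rewrite /s -real_normK ?num_real// ltr_pXn2r ?nnegrE// ltW.
Qed.

(** The line is totally bounded for this distance: a grid of mesh [1 / M] on [[-M, M]] is fine
    enough inside, and its end points serve for everything outside. *)
Lemma chord_net eta : 0 < eta -> exists s : seq R, forall x,
  exists2 a, a \in s & chord x a < eta.
Proof.
move=> eta0.
have [M M1] : exists M : nat, Num.max 1 (eta^-1) < M%:R :> R.
  exists (Num.truncn (Num.max 1 eta^-1)).+1; exact: truncnS_gt.
have [M1' Me] : 1 < M%:R :> R /\ eta^-1 < M%:R :> R by move: M1; rewrite gt_max => /andP[].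
have M0 : 0 < M%:R :> R by lra.
have MM : eta^-1 < M%:R ^+ 2 :> R by rewrite (lt_trans Me)// ltr_eXnr.
have MMe : (M%:R ^+ 2)^-1 < eta :> R by rewrite invf_plt ?posrE// exprn_gt0.
pose a (k : nat) : R := k%:R / M%:R - M%:R.
exists [seq a k | k <- iota 0 (2 * M ^ 2).+1] => x.
have [xM|xM] := lerP `|x| M%:R.
  have y0 : 0 <= (x + M%:R) * M%:R.
    move: xM; rewrite ler_norml => /andP[xM _].
    by rewrite mulr_ge0 ?(ltW M0)//; lra.
  have /andP[ky yk] := truncn_itv y0.
  set k := Num.truncn _ in ky yk.
  exists (a k).
    apply: map_f; rewrite mem_iota/= add0n ltnS -(ler_nat R) (le_trans ky)//.
    rewrite natrM natrX expr2 mulrA ler_pM2r// mulr_natl mulr2n lerD2r.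
    exact: le_trans (ler_norm _) xM.
  apply: le_lt_trans MMe; rewrite /chord ler_pdivrMr ?mulr_gt0//.
  have xa : x - a k = ((x + M%:R) * M%:R - k%:R) / M%:R by rewrite /a; field; rewrite gt_eqF.
  rewrite xa expr_div_n mulrC ler_pM2l ?invr_gt0 ?exprn_gt0//.
  apply: (@le_trans _ _ 1).
    rewrite -natr1 in yk.
    by apply: exprn_ile1; lra.
  by have := sqr_ge0 x; have := sqr_ge0 (a k); nra.
(* The second premise holds for the end point [b] on the side of [x], and bounds the chord by
   [1 / (1 + M ^+ 2)]. *)
have far (b : R) : b ^+ 2 = M%:R ^+ 2 -> (x - b) ^+ 2 <= x ^+ 2 -> chord x b < eta.
  move=> b2 xb; apply: le_lt_trans MMe; rewrite /chord b2.
  rewrite ler_pdivrMr ?mulr_gt0// ler_pdivlMl ?exprn_gt0//.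
  by have := sqr_ge0 x; have := sqr_ge0 (M%:R : R); nra.
have [x0|x0] := leP 0 x.
  rewrite ger0_norm// in xM.
  exists (a (2 * M ^ 2)%N); first by apply: map_f; rewrite mem_iota/= add0n.
  have -> : a (2 * M ^ 2)%N = M%:R.
    by rewrite /a natrM natrX; field; rewrite gt_eqF.
  by apply: far => //; nra.
rewrite ltr0_norm// in xM.
exists (a 0); first by apply: map_f; rewrite mem_iota.
have -> : a 0 = - M%:R by rewrite /a mul0r sub0r.
by apply: far; [rewrite sqrrN|nra].
Qed.

End Chordal.

(** * Uniform continuity and boundedness on compact sets *)

Section Compactness.
Variables (R : realType) (X : normedModType R) (B : set X) (g : X -> R[i]).
Hypotheses (cB : compact B) (cg : continuous g).

(** Only one of the two points has to lie in the compact set, so that trajectories leaving [B] are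
    covered. Compactness is used in its near-covering form, with the radius [d] as the parameter
    tending to 0. *)
Lemma compact_uniformly_continuous (e : R[i]) : 0 < e ->
  exists2 d : R, 0 < d & forall x y, B x -> `|x - y| < d -> `|g x - g y| < e.
Proof.
move=> e0; have e2 : 0 < e / 2 by rewrite divr_gt0.
have /(_ R (0^'+) (fun d x => forall y, `|x - y| < d -> `|g x - g y| < e) _) :=
  (compact_near_coveringP B).1 cB.
case=> [x Bx|d /= d0 dP].
  have [r /= r0 rP] : exists2 r : R, 0 < r & ball x r `<=` [set y | `|g x - g y| < e / 2].
    by apply/nbhs_ballP; exact: (@cvgr_dist_lt _ R[i] _ (nbhs x) _ g (g x) (@cg x)).
  exists (ball x (r / 2), [set d | d < r / 2]).
    split; first by apply: nbhsx_ballx; rewrite divr_gt0.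
    by apply: nbhs_right_lt; rewrite divr_gt0.
  move=> [x' d]/= [xx' dr] y x'y.
  rewrite [e]splitr (_ : g x' - g y = (g x' - g x) + (g x - g y)); last by ring.
  rewrite (le_lt_trans (ler_normD _ _))// ltrD//.
    rewrite distrC; apply: rP; apply: le_ball xx'.
    by rewrite ler_pdivrMr// ler_pMr// ler1n.
  apply: rP; rewrite [r]splitr; apply: ball_triangle xx' _.
  by rewrite -ball_normE/=; exact: lt_trans dr.
exists (d / 2); first by rewrite divr_gt0.
move=> x y Bx xy; apply: (dP (d / 2)) => //=; last by rewrite divr_gt0.
by rewrite sub0r normrN gtr0_norm ?divr_gt0// ltr_pdivrMr// ltr_pMr// ltr1n.
Qed.

Lemma compact_bounded_complex :
  exists2 M : R, 0 < M & forall x, B x -> `|g x| <= M%:C%C.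
Proof.
have /(_ R +oo%R (fun M x => `|g x| <= M%:C%C) _) := (compact_near_coveringP B).1 cB.
case=> [x Bx|M [_ MP]].
  have xP : \forall y \near x, `|g x - g y| < 1.
    by apply: (@cvgr_dist_lt _ R[i] _ (nbhs x) _ g (g x) (@cg x)); exact: ltr01.
  have [r r0 rE] := normC_complex (g x).
  exists ([set y | `|g x - g y| < 1], [set M | r + 1 < M]).
    by split => //; exists (r + 1); split => //; exact: num_real.
  move=> [y M]/= [xy rM]; rewrite -(subKr (g x) (g y)).
  rewrite (le_trans (ler_normB _ _))// rE.
  apply: (@le_trans _ _ ((r + 1)%:C%C)); last by rewrite lecR ltW.
  by rewrite rmorphD lerD2l ltW.
exists (Num.max 1 (M + 1)); first by rewrite lt_max ltr01.
by move=> x; apply: MP; rewrite lt_max ltrDl ltr01 orbT.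
Qed.

End Compactness.

(** * Approximation of functions vanishing at infinity by resolvents *)

Section StoneWeierstrass.
Variables (R : realType) (X : innerProductType R) (I : finType) (e : I -> X).
Hypotheses (e_on : forall i j, inner (e i) (e j) = (i == j)%:R)
           (e_norm : forall x, `|x| ^+ 2 = \sum_i inner (e i) x ^+ 2).

Let coord i x := inner (e i) x.
(** The added 1 allows division by [n1] even when [I] is empty. *)
Let n1 : R := #|I|%:R + 1.
Let n1_gt0 : 0 < n1. Proof. by rewrite ltr_wpDl. Qed.
Let q (a x : X) : R := \sum_i chord (coord i x) (coord i a).

Let coord_le i x : `|coord i x| <= `|x|.
Proof.
apply: le_trans (inner_le _ _) _.
have -> : `|e i| = 1.
  apply/eqP; rewrite -(@eqrXn2 _ 2)// -innerxx e_on eqxx expr1n//.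
by rewrite mul1r.
Qed.

Let q_ge0 a x : 0 <= q a x.
Proof. by apply: sumr_ge0 => i _; exact: chord_ge0. Qed.

Let q_le a x : q a x <= n1.
Proof.
apply: (@le_trans _ _ (\sum_(i : I) 1)); last by rewrite sumr_const lerDl.
by apply: ler_sum => i _; exact: chord_le1.
Qed.

Lemma norm_coord_lt x d : 0 < d -> (forall i, `|coord i x| < d / n1) -> `|x| < d.
Proof.
move=> d0 xd; rewrite -(@ltr_pXn2r _ 2) ?nnegrE// ?ltW// e_norm.
apply: (@le_lt_trans _ _ (\sum_(i : I) (d / n1) ^+ 2)).
  apply: ler_sum => i _; rewrite -real_normK ?num_real// lerXn2r ?nnegrE//.
    by rewrite divr_ge0// ltW.
  by rewrite ltW// xd.
rewrite sumr_const -mulr_natl expr_div_n mulrCA gtr_pMr ?exprn_gt0//.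
by rewrite ltr_pdivrMr ?exprn_gt0// mul1r /n1; have := ler0n R #|I|; nra.
Qed.

(** From [1/(i-r) - 1/(i-s) = (r-s)/((i-r)(i-s))], where [i - t] has squared modulus [1 + t^2]. This
    identity places the chordal distances to a fixed point in the resolvent algebra. *)
Let resolvent_chord i a x : (chord (coord i x) (coord i a))%:C%C =
  (resolvent_fun (e i) 1 x - resolvent_fun (e i) 1 a) *
  (resolvent_fun (e i) 1 x - resolvent_fun (e i) 1 a)^*.
Proof.
rewrite /resolvent_fun /chord mulr1 -/(coord i x) -/(coord i a).
move: (coord i x) (coord i a) => r s.
have nz (t : R) : 'i - t%:C%C != 0 :> R[i].
  by have := @resolvent_denom_neq0 R 1 t (oner_neq0 _); rewrite mulr1.
have nzJ (t : R) : - 'i - t%:C%C != 0 :> R[i].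
  by have := nz (- t); rewrite rmorphN opprK -oppr_eq0 opprD.
have nzM (t : R) : ('i - t%:C%C) * (- 'i - t%:C%C) = (1 + t ^+ 2)%:C%C :> R[i].
  rewrite (_ : _ * _ = - 'i ^+ 2 + t%:C%C ^+ 2); last by ring.
  by rewrite sqrCi opprK rmorphD rmorphXn.
have J (t : R) : ((t%:C%C)^* : R[i]) = t%:C%C.
  by apply: conj_Creal; rewrite complex_real.
have JV (t : R) : (('i - t%:C%C)^-1)^* = (- 'i - t%:C%C)^-1 :> R[i].
  by rewrite fmorphV rmorphB/= conjCi J.
rewrite [in RHS]rmorphB/= !JV.
have -> : ((r - s) ^+ 2 / ((1 + r ^+ 2) * (1 + s ^+ 2)))%:C%C =
    (r%:C%C - s%:C%C) ^+ 2 / ((1 + r ^+ 2)%:C%C * (1 + s ^+ 2)%:C%C) :> R[i].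
  by rewrite rmorphM fmorphV rmorphXn rmorphB -rmorphM.
rewrite -!nzM.
by field; rewrite !nz !nzJ.
Qed.

Let CR_q a : CR X (fun x => (1 - q a x / n1)%:C%C).
Proof.
have AA := Cstar_subalgebra_CR X.
rewrite (_ : (fun _ => _) = fun x => 1 - (n1^-1)%:C%C *
    \sum_i (chord (coord i x) (coord i a))%:C%C); last first.
  by apply/funext => x; rewrite -rmorph_sum -rmorphM -rmorphB mulrC.
apply: (CstarB AA); first exact: CR_cst.
apply: (CstarZ AA); apply: (Cstar_sum AA) => i.
rewrite (_ : (fun _ => _) = fun x =>
    (resolvent_fun (e i) 1 x - resolvent_fun (e i) 1 a) *
    (resolvent_fun (e i) 1 x - resolvent_fun (e i) 1 a)^*); last first.
  by apply/funext => x; exact: resolvent_chord.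
have h : CR X (fun x => resolvent_fun (e i) 1 x - resolvent_fun (e i) 1 a).
  by apply: (CstarB AA); [exact: CR_resolvent (oner_neq0 _)|exact: CR_cst].
by apply: (CstarM AA) => //; exact: (CstarJ AA).
Qed.

(** [Cstar_weights] is applied to [1 - q a x / n1] for [a] in a finite net: every [x] has a net
    point with [q] at most [eta / 2], and points with [q] below [eta] have nearby values of [g]. *)
Lemma CR_C0 g : C0 R X g -> CR X g.
Proof.
move=> [cg g0]; have AA := Cstar_subalgebra_CR X.
have /closed_uniformP := Cstar_closed AA; apply => eps eps0.
have eps2 : 0 < eps / 2 by rewrite divr_gt0.
have eps4 : 0 < eps / 2 / 2 by rewrite divr_gt0.
have [B cB gB] := g0 _ eps4.
have [r [_ rB]] := compact_bounded cB.
have {}rB x : B x -> `|x| <= r + 1 by apply: rB; rewrite ltrDl.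
have [M M0 gM] := compact_bounded_complex cB cg.
have [N N0 gN] : exists2 N : R, 0 < N & forall x, `|g x| <= N%:C%C.
  have [d d0 dE] := gt0_complex eps4.
  exists (Num.max M d); first by rewrite lt_max M0.
  move=> x; have [/gM Bx|/gB nBx] := pselect (B x).
    by apply: le_trans Bx _; rewrite lecR le_max lexx.
  by apply: (le_trans (ltW nBx)); rewrite dE lecR le_max lexx orbT.
have [d d0 dP] := compact_uniformly_continuous cB cg eps2.
have dn : 0 < d / n1 by rewrite divr_gt0.
have [eta0 eta00 etaP] := chord_dist (r + 1) dn.
(* The cap at 1 keeps the lower threshold [1 - eta / n1] nonnegative. *)
pose eta := Num.min eta0 1.
have eta_gt0 : 0 < eta by rewrite lt_min eta00 ltr01.
have eta1 : eta <= 1 by rewrite ge_min lexx orbT.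
have close x a : q a x < eta -> B x -> `|x - a| < d.
  move=> qx Bx; apply: norm_coord_lt => // i; rewrite /coord innerBr.
  apply: etaP; first by rewrite (le_trans (coord_le _ _))// rB.
  apply: le_lt_trans (lt_le_trans qx _); last by rewrite ge_min lexx.
  by rewrite /q (bigD1 i)//= lerDl sumr_ge0// => j _; exact: chord_ge0.
have qC a x : q a x = q x a.
  apply: eq_bigr => i _; rewrite /chord [X in _ / X]mulrC.
  by rewrite -[in LHS]sqrrN opprB.
(* Fewer than [n1] coordinates with error [eta / (2 * n1)] each add up to at most [eta / 2]. The net
   in [X] consists of all combinations of coordinates from [s]. *)
have [s sP] := chord_net (divr_gt0 eta_gt0 (mulr_gt0 (ltr0n R 2) n1_gt0)).
pose J : finType := {ffun I -> 'I_(size s)}.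
pose a (j : J) : X := \sum_i s`_(j i) *: e i.
have aE j i : coord i (a j) = s`_(j i).
  rewrite /coord /a inner_sumr (bigD1 i)//= big1 => [|k ki].
    by rewrite innerZr e_on eqxx mulr1 addr0.
  by rewrite innerZr e_on eq_sym (negPf ki) mulr0.
have [|||||||||h Ah gh] := @Cstar_weights _ X _ AA (CR_cst 1) J
  (fun j x => 1 - q (a j) x / n1) (fun j => g (a j)) g
  (1 - eta / 2 / n1) (1 - eta / n1) (N + N) (eps / 2).
- by move=> j; exact: CR_q.
- by rewrite subr_ge0 ler_pdivrMr// mul1r (le_trans eta1)// lerDr.
- by rewrite ltrD2l ltrN2 ltr_pM2r ?invr_gt0// ltr_pdivrMr// ltr_pMr// ltr1n.
- exact: addr_gt0.
- by [].
- move=> j x; rewrite subr_ge0 ler_pdivrMr// mul1r q_le/= lerBlDr lerDl.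
  by rewrite divr_ge0// ltW.
- move=> x.
  have sE i : exists k : 'I_(size s), chord (coord i x) s`_k < eta / (2 * n1).
    have [t ts tP] := sP (coord i x).
    have ks : (index t s < size s)%N by rewrite index_mem.
    by exists (Ordinal ks); rewrite /= nth_index.
  exists [ffun i => sval (cid (sE i))].
  rewrite lerD2l lerN2 ler_pM2r ?invr_gt0// /q.
  apply: (@le_trans _ _ (\sum_(i : I) eta / (2 * n1))).
    by apply: ler_sum => i _; rewrite aE ffunE ltW//; exact: svalP (cid (sE i)).
  rewrite sumr_const -[leLHS]mulr_natr mulrAC ler_pdivrMr ?mulr_gt0//.
  rewrite (_ : eta / 2 * (2 * n1) = eta * n1); last by field.
  by rewrite ler_pM2l// /n1 lerDl.
- by move=> j x; rewrite rmorphD (le_trans (ler_normB _ _))// lerD.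
(* If [x] or [a j] is in [B], uniform continuity applies from that point; otherwise both values of
   [g] are below [eps / 4]. *)
- move=> j x; rewrite ltrD2l ltrN2 ltr_pM2r ?invr_gt0// => qx.
  have [Bx|nBx] := pselect (B x); first by apply: dP => //; exact: close.
  have [Ba|nBa] := pselect (B (a j)).
    by rewrite distrC; apply: dP => //; apply: close => //; rewrite qC.
  by rewrite (le_lt_trans (ler_normB _ _))// [ltRHS]splitr ltrD// gB.
by exists h => // x; rewrite [eps]splitr.
Qed.

End StoneWeierstrass.

(** * Differential inequalities and Lipschitz functions *)

Section Derivatives.
Variable R : realType.

Section Pointwise.
Variables (V W : normedModType R) (x v : V).

Lemma is_deriveDf (f g : V -> W) a b : is_derive x v f a -> is_derive x v g b ->
  is_derive x v (fun y => f y + g y) (a + b).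
Proof. by move=> fa gb; exact: is_deriveD. Qed.

Lemma is_derive_bigsum (I : Type) (s : seq I) (f : I -> V -> W) (a : I -> W) :
  (forall i, is_derive x v (f i) (a i)) ->
  is_derive x v (fun y => \sum_(i <- s) f i y) (\sum_(i <- s) a i).
Proof.
move=> fa; elim: s => [|i s IH].
  rewrite big_nil (_ : (fun _ => _) = cst 0); first exact: is_derive_cst.
  by apply/funext => y; rewrite big_nil.
rewrite big_cons (_ : (fun _ => _) = fun y => f i y + \sum_(j <- s) f j y).
  exact: is_deriveDf.
by apply/funext => y; rewrite big_cons.
Qed.

(** Restriction to a line has the same difference quotients; this turns directional derivatives into
    derivatives in one real variable. *)
Lemma is_derive_line (f : V -> W) D :
  is_derive (0 : R) 1 (fun h => f (h *: v + x)) D <-> is_derive x v f D.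
Proof.
have E : (fun h : R => h^-1 *: (((fun h => f (h *: v + x)) \o shift 0) (h *: 1) -
      (fun h => f (h *: v + x)) 0)) =
    (fun h => h^-1 *: ((f \o shift x) (h *: v) - f x)).
  by apply/funext => h /=; rewrite addr0 scale0r add0r /GRing.scale/= mulr1.
by split=> -[fd fD]; split; move: fd fD; rewrite /derivable /derive E.
Qed.

End Pointwise.

Lemma is_derive_line_at (V W : normedModType R) (x v : V) (f : V -> W) D (s : R) :
  is_derive (s *: v + x) v f D -> is_derive s 1 (fun h => f (h *: v + x)) D.
Proof.
move=> /is_derive_line fD; apply/is_derive_line.
rewrite (_ : (fun _ => _) = fun h : R => f (h *: v + (s *: v + x)))//.
by apply/funext => h; rewrite addrA -scalerDl /GRing.scale/= mulr1.
Qed.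

Lemma is_derive_comp_scale (f : R -> R) (c D : R) : is_derive (0 : R) 1 f D ->
  is_derive (0 : R) 1 (fun h => f (c * h)) (c * D).
Proof.
move=> fD; rewrite mulrC; apply: (@is_derive1_comp R f ( *%R c)).
  by rewrite mulr0.
have := @is_deriveZ R _ _ id c (0 : R) 1 1 (is_derive_id _ _).
by rewrite /GRing.scale/= mulr1.
Qed.

Lemma is_derive_quadratic (a b c : R) :
  is_derive (0 : R) 1 (fun h => a * h ^+ 2 + b * h + c) b.
Proof.
have h1 : is_derive (0 : R) 1 (fun h : R => h) 1 by exact: is_derive_id.
have h2 := @is_deriveX _ _ _ 2 _ _ _ h1.
rewrite /= mulr0 scale0r in h2.
have := is_deriveDf (is_deriveDf (@is_deriveZ _ _ _ _ a _ _ _ h2)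
  (@is_deriveZ _ _ _ _ b _ _ _ h1)) (@is_derive_cst _ _ _ c _ _).
by rewrite scaler0 add0r addr0 /GRing.scale/= mulr1.
Qed.

Lemma is_derive_sqr (f : R -> R) (t D : R) : is_derive t 1 f D ->
  is_derive t 1 (fun s => f s ^+ 2) (2 * f t * D).
Proof. by move=> fD; have := @is_deriveX _ _ _ 2 _ _ _ fD; rewrite expr1. Qed.

Lemma is_derive_inner (X : innerProductType R) (u : X) (f : R -> X) (t : R) (D : X) :
  is_derive t 1 f D -> is_derive t 1 (fun s => inner u (f s)) (inner u D).
Proof.
move=> fD.
have : (fun h : R => h^-1 *: ((f \o shift t) (h *: 1) - f t)) @ 0^' --> D.
  rewrite -(@derive_val _ _ _ _ _ _ _ fD); exact: (@ex_derive _ _ _ _ _ _ _ fD).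
move=> cf.
have cD : (fun h : R => h^-1 *: (((fun s => inner u (f s)) \o shift t) (h *: 1)
     - inner u (f t))) @ 0^' --> inner u D.
  rewrite (_ : (fun _ => _) =
      inner u \o (fun h : R => h^-1 *: ((f \o shift t) (h *: 1) - f t))).
    by apply: (cvg_comp _ _ cf); exact: inner_continuous.
  by apply/funext => h; rewrite /= innerZr innerBr.
split; first exact: cvgP cD.
exact: (cvg_lim _ cD).
Qed.

Lemma is_derive_continuous (W : normedModType R) (f : R -> W) (df : R -> W) :
  (forall t : R, is_derive t 1 f (df t)) -> continuous f.
Proof.
move=> fD t; apply: differentiable_continuous; apply/derivable1_diffP.
exact: (@ex_derive _ _ _ _ _ _ _ (fD t)).
Qed.

Lemma is_derive_within_continuous (f df : R -> R) (a b : R) :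
  (forall t : R, t \in `[a, b] -> is_derive t 1 f (df t)) -> {within `[a, b], continuous f}.
Proof.
move=> fD; apply: derivable_within_continuous => t /fD h.
exact: (@ex_derive _ _ _ _ _ _ _ h).
Qed.

Lemma is_derive_opp (f : R -> R) (t D : R) : is_derive (- t) 1 f D ->
  is_derive t 1 (fun s => f (- s)) (- D).
Proof.
move=> fD; by rewrite -[- D]mulrN1; apply: (@is_derive1_comp R f -%R).
Qed.

(** Negative [t] is reduced to positive [t] by reflecting the time axis, which the symmetric
    hypotheses allow. *)
Lemma mean_value_le (f df : R -> R) (K t : R) :
  (forall s : R, `|s| <= `|t| -> is_derive s 1 f (df s)) ->
  (forall s, `|s| <= `|t| -> `|df s| <= K) ->
  `|f t - f 0| <= K * `|t|.
Proof.
have pos (g dg : R -> R) (u : R) : 0 <= u ->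
    (forall s : R, `|s| <= u -> is_derive s 1 g (dg s)) ->
    (forall s, `|s| <= u -> `|dg s| <= K) -> `|g u - g 0| <= K * u.
  move=> u0 gD gK.
  have itv s : s \in `[0, u] -> `|s| <= u.
    by rewrite in_itv/= => /andP[s0 su]; rewrite ger0_norm.
  have [||c cu ->] := @MVT_segment R g dg 0 u u0.
  - by move=> s su; apply: gD; apply: itv; apply: subset_itv_oo_cc.
  - by apply: (@is_derive_within_continuous _ dg) => s su; apply: gD; exact: itv.
  - by rewrite subr0 normrM (ger0_norm u0) ler_wpM2r// gK// itv.
move=> fD fK; have [t0|t0] := leP 0 t.
  by rewrite (ger0_norm t0) in fD fK *; exact: pos fD fK.
rewrite (ltr0_norm t0) in fD fK *.
have := pos (fun s => f (- s)) (fun s => - df (- s)) (- t).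
rewrite opprK oppr0; apply.
- by rewrite oppr_ge0 ltW.
- by move=> s st; apply: is_derive_opp; apply: fD; rewrite normrN.
- by move=> s st; rewrite normrN; apply: fK; rewrite normrN.
Qed.

(** For positive times [expR (- K * s) * u s] is nonincreasing; negative times follow by
    reflection. *)
Lemma gronwall (u du : R -> R) (K T : R) :
  (forall t : R, is_derive t 1 u (du t)) ->
  (forall t, `|t| <= T -> `|du t| <= K * u t) ->
  forall t, `|t| <= T -> u t <= expR (K * `|t|) * u 0.
Proof.
have pos (v dv : R -> R) (t : R) : 0 <= t -> t <= T ->
    (forall t : R, is_derive t 1 v (dv t)) ->
    (forall t, `|t| <= T -> `|dv t| <= K * v t) -> v t <= expR (K * t) * v 0.
  move=> t0 tT vD vK.
  pose w (s : R) := expR (- K * s) * v s.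
  have wD (s : R) : is_derive s 1 w (expR (- K * s) * (dv s - K * v s)).
    have e1 : is_derive s 1 (fun s => expR (- K * s)) (- K * expR (- K * s)).
      rewrite mulrC; apply: (@is_derive1_comp R expR ( *%R (- K))).
      have := @is_deriveZ R _ _ id (- K) s 1 1 (is_derive_id _ _).
      by rewrite /GRing.scale/= mulr1.
    have := is_deriveM e1 (vD s).
    rewrite /GRing.scale/= (_ : _ + _ = expR (- K * s) * (dv s - K * v s))//.
    by ring.
  have := @ler0_derive1_nincr R w 0 t _ _ _ 0 t (lexx _) t0 (lexx _).
  rewrite /w mulr0 expR0 mul1r mulNr expRN => h.
  rewrite -ler_pdivrMl ?expR_gt0//; apply: h.
  - by move=> s _; exact: (@ex_derive _ _ _ _ _ _ _ (wD s)).
  - move=> s; rewrite in_itv/= => /andP[s0 st].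
    rewrite derive1E (@derive_val _ _ _ _ _ _ _ (wD s)).
    rewrite pmulr_rle0 ?expR_gt0// subr_le0 (le_trans (ler_norm _))// vK//.
    by rewrite gtr0_norm// (le_trans (ltW st)).
  - by apply: (@is_derive_within_continuous _ _ _ _ (fun s _ => wD s)).
move=> uD uK t tT; have [t0|t0] := leP 0 t.
  by rewrite (ger0_norm t0) in tT *; exact: pos uD uK.
rewrite (ltr0_norm t0) in tT *.
have := pos (fun s => u (- s)) (fun s => - du (- s)) (- t).
rewrite opprK oppr0; apply => //.
- by rewrite oppr_ge0 ltW.
- by move=> s; exact: is_derive_opp.
- by move=> s st; rewrite normrN; apply: uK; rewrite normrN.
Qed.

End Derivatives.

Section RowNorm.
Variables (R : realType) (n : nat).
Implicit Types x : 'rV[R]_n.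

Lemma row_coord_le x j : `|x 0 j| <= `|x|.
Proof.
rewrite [leRHS]mx_normrE.
exact: (le_bigmax _ (fun ij : 'I_1 * 'I_n => `|x ij.1 ij.2|) (0, j)).
Qed.

Lemma row_norm_le x (r : R) : 0 <= r -> (forall j, `|x 0 j| <= r) -> `|x| <= r.
Proof.
move=> r0 xr; rewrite [leLHS]mx_normrE; apply: bigmax_le => // -[i j] _ /=.
by rewrite ord1.
Qed.

Lemma compact_row_ball (r : R) : compact [set x : 'rV[R]_n | `|x| <= r].
Proof.
apply: bounded_closed_compact.
  by exists r; split; [exact: num_real|move=> M rM x /= xr; rewrite (le_trans xr)// ltW].
have := @closed_closed_ball_ R _ (0 : 'rV[R]_n) r.
rewrite (_ : closed_ball_ _ _ _ = [set x | `|x| <= r])//.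
by apply/seteqP; split=> x; rewrite /closed_ball_/= sub0r normrN.
Qed.

End RowNorm.

(** * Functions that are Lipschitz on balls *)

Section LocallyLipschitz.
Variable R : realType.

(** One constant per ball around the origin, so that it serves along a whole bounded piece of
    trajectory. *)
Definition locally_lipschitz (X : normedModType R) (f : X -> R) : Prop :=
  forall r : R, exists2 K, 0 <= K &
    forall x y, `|x| <= r -> `|y| <= r -> `|f x - f y| <= K * `|x - y|.

Section Closure.
Variable X : normedModType R.
Implicit Types f g : X -> R.

Lemma locally_lipschitzD f g : locally_lipschitz f -> locally_lipschitz g ->
  locally_lipschitz (fun x => f x + g x).
Proof.
move=> lf lg r; have [K K0 fK] := lf r; have [L L0 gL] := lg r.
exists (K + L) => [|x y xr yr]; first exact: addr_ge0.
rewrite opprD addrACA mulrDl (le_trans (ler_normD _ _))// lerD//.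
  exact: fK.
exact: gL.
Qed.

Lemma locally_lipschitzZ c f : locally_lipschitz f ->
  locally_lipschitz (fun x => c * f x).
Proof.
move=> lf r; have [K K0 fK] := lf r.
exists (`|c| * K) => [|x y xr yr]; first exact: mulr_ge0.
by rewrite -mulrBr normrM -mulrA ler_wpM2l// fK.
Qed.

Lemma locally_lipschitz_cst c : locally_lipschitz (fun _ : X => c).
Proof. by move=> r; exists 0 => // x y _ _; rewrite subrr normr0 mul0r. Qed.

Lemma locally_lipschitz_sum (I : Type) (s : seq I) (f : I -> X -> R) :
  (forall i, locally_lipschitz (f i)) -> locally_lipschitz (fun x => \sum_(i <- s) f i x).
Proof.
move=> lf; elim: s => [|i s IH].
  rewrite (_ : (fun _ => _) = fun=> 0); first exact: locally_lipschitz_cst.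
  by apply/funext => x; rewrite big_nil.
rewrite (_ : (fun _ => _) = fun x => f i x + \sum_(j <- s) f j x).
  exact: locally_lipschitzD.
by apply/funext => x; rewrite big_cons.
Qed.

Lemma locally_lipschitz_comp (Y : normedModType R) (h : Y -> X) f (c : R) :
  (forall x y, `|h x - h y| <= c * `|x - y|) -> (h 0 = 0) -> locally_lipschitz f ->
  locally_lipschitz (f \o h).
Proof.
move=> hc h0 lf r; have hb x : `|x| <= r -> `|h x| <= `|c| * r.
  move=> xr; rewrite -[h x]subr0 -h0 (le_trans (hc _ _))// subr0.
  apply: (@le_trans _ _ (`|c| * `|x|)); first by rewrite ler_wpM2r// ler_norm.
  by rewrite ler_wpM2l.
have [K K0 fK] := lf (`|c| * r).
exists (K * `|c|) => [|x y xr yr]; first exact: mulr_ge0.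
rewrite (le_trans (fK _ _ (hb _ xr) (hb _ yr)))// -mulrA ler_wpM2l//.
by rewrite (le_trans (hc _ _))// ler_wpM2r// ler_norm.
Qed.

End Closure.

(** The points [w] and [z] are joined by exchanging one coordinate at a time ([mix]), so that each
    step only involves one partial derivative. *)
Lemma C1_locally_lipschitz (n : nat) (f : 'rV[R]_n -> R) :
  (forall j x, derivable f x 'e_j) -> (forall j, continuous (partial j f)) ->
  locally_lipschitz f.
Proof.
move=> fD fC r.
(* [mean_value_le] asks for a bound on both sides of the starting point: norm at most [r], plus a
   step of size at most [r + r]. *)
have bnd j : exists2 K : R, 0 <= K & forall x, `|x| <= r + (r + r) -> `|partial j f x| <= K.
  have /compact_bounded[M [_ MP]] : compact (partial j f @` [set x : 'rV[R]_n | `|x| <= r + (r + r)]).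
    apply: continuous_compact; last exact: compact_row_ball.
    exact: continuous_subspaceT.
  exists (`|M| + 1) => [|x xr]; first by rewrite addr_ge0.
  by apply: MP; [rewrite (le_lt_trans (ler_norm _))// ltrDl|exists x].
pose K j := s2val (cid2 (bnd j)).
have K0 j : 0 <= K j by exact: (s2valP (cid2 (bnd j))).
have KP j x : `|x| <= r + (r + r) -> `|partial j f x| <= K j.
  exact: (s2valP' (cid2 (bnd j))).
exists (\sum_j K j) => [|z w zr wr]; first exact: sumr_ge0.
pose mix i : 'rV[R]_n := \row_j (if (j < i)%N then z 0 j else w 0 j).
have r0 : 0 <= r by exact: le_trans zr.
have mixr i : `|mix i| <= r.
  apply: row_norm_le => // j; rewrite mxE; case: ifP => _.
    by rewrite (le_trans (row_coord_le _ _)).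
  by rewrite (le_trans (row_coord_le _ _)).
have mix0 : mix 0 = w by apply/rowP => j; rewrite mxE.
have mixn : mix n = z by apply/rowP => j; rewrite mxE ltn_ord.
have step (j : 'I_n) : `|f (mix j.+1) - f (mix j)| <= K j * `|z - w|.
  have -> : mix j.+1 = (z 0 j - w 0 j) *: 'e_j + mix j.
    apply/rowP => i; rewrite !mxE eqxx/= ltnS leq_eqVlt (inj_eq val_inj).
    case: (eqVneq i j) => [->|_]; rewrite /= ?ltnn ?mulr1 ?subrK// mulr0 add0r//.
  have e1 : `|'e_j : 'rV[R]_n| <= 1.
    by apply: row_norm_le => // i; rewrite mxE eqxx/=; case: (_ == _); rewrite ?normr1 ?normr0.
  have zw : `|z 0 j - w 0 j| <= `|z - w|.
    by have := row_coord_le (z - w) j; rewrite !mxE.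
  have zwr : `|z 0 j - w 0 j| <= r + r.
    by apply: (le_trans zw); rewrite (le_trans (ler_normB _ _))// lerD.
  have := @mean_value_le R (fun s => f (s *: 'e_j + mix j))
     (fun s => partial j f (s *: 'e_j + mix j)) (K j) (z 0 j - w 0 j).
  rewrite scale0r add0r => h; apply: (le_trans (h _ _)).
  - by move=> s _; apply: is_derive_line_at; apply: derivableP; exact: fD.
  - move=> s sz; apply: KP; rewrite addrC (le_trans (ler_normD _ _))// lerD//.
    rewrite normrZ (le_trans (ler_piMr _ e1))//.
    exact: le_trans zwr.
  - by rewrite ler_wpM2l.
rewrite -{1}mixn -{1}mix0 -(telescope_sumr (fun i => f (mix i)) (leq0n n)).
rewrite big_mkord mulr_suml (le_trans (ler_norm_sum _ _ _))// ler_sum//.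
Qed.

End LocallyLipschitz.

(** * The Hamiltonian flow in finite volume *)

Section Coordinates.
Variables (R : realType) (d : nat) (G : choiceType).
Notation site := ('rV[R]_d * 'rV[R]_d)%type.

(* [b] selects the momentum ([true]) or the position ([false]). *)
Definition site_dir (b : bool) (j : 'I_d) : site :=
  if b then ('e_j, 0) else (0, 'e_j).

Definition comp (b : bool) (k : G) (j : 'I_d) (x : phase R d G) : R :=
  (if b then momentum x k else position x k) 0 j.

Lemma compD b k j (x y : phase R d G) : comp b k j (x + y) = comp b k j x + comp b k j y.
Proof. by case: b; rewrite /comp /momentum /position /= mxE. Qed.

Lemma compZ b k j a (x : phase R d G) : comp b k j (a *: x) = a * comp b k j x.
Proof. by case: b; rewrite /comp /momentum /position /= mxE. Qed.

Section Local.
Variable L : {fset G}.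
Notation lp := (local_phase R d L).

(** These are the directions of [grad_p] (for [b = true]) and of [grad_q] (for [b = false]). *)
Definition unit_dir (k : G) (b : bool) (j : 'I_d) : lp :=
  truncate L (fun l => if l == k then site_dir b j else 0).

Lemma local_innerE (x y : lp) : inner x y = \sum_(k <- L)
  (dotv (momentum x k) (momentum y k) + dotv (position x k) (position y k)).
Proof.
rewrite -[LHS]/(phase_inner _ _) (@phase_innerE _ _ _ [set` L]).
- by rewrite set_fsetK.
- exact: finite_fset.
- move=> k /= xk; apply: contraNT xk => kL.
  by have /asboolP -> := local_phaseP x.
Qed.

Lemma dotv_delta j (u : 'rV[R]_d) : dotv 'e_j u = u 0 j.
Proof.
rewrite /dotv (bigD1 j)//= mxE !eqxx mul1r big1 ?addr0// => i ij.
by rewrite mxE (negPf ij) andbF mul0r.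
Qed.

Lemma comp_unit_dir b k j b' k' j' : k \in L ->
  comp b k j (unit_dir k' b' j') = ((b == b') && (k == k') && (j == j'))%:R.
Proof.
move=> kL; rewrite /comp /momentum /position /= kL.
by case: (k == k'); case: b b' => -[]; rewrite /= mxE ?andbT//= eqxx.
Qed.

Lemma inner_unit_dir k b j (x : lp) : k \in L -> inner (unit_dir k b j) x = comp b k j x.
Proof.
move=> kL; rewrite local_innerE (big_fsetD1 k)//= big_seq big1 ?addr0 => [|l].
  rewrite /comp /momentum /position /= kL eqxx.
  by case: b; rewrite /= dotv0l ?addr0 ?add0r dotv_delta.
rewrite !inE => /andP[lk lL].
by rewrite /momentum /position /= lL (negPf lk) !dotv0l addr0.
Qed.

Definition unit_index : finType := (L * bool * 'I_d)%type.
Definition unit_vec (i : unit_index) : lp := unit_dir (val i.1.1) i.1.2 i.2.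

Lemma inner_unit_vec i x : inner (unit_vec i) x = comp i.1.2 (val i.1.1) i.2 x.
Proof. by rewrite inner_unit_dir// fsvalP. Qed.

(** With the Parseval identity [unit_vec_norm], this supplies the basis required by [CR_C0]. *)
Lemma unit_vec_orthonormal i j : inner (unit_vec i) (unit_vec j) = (i == j)%:R.
Proof.
rewrite inner_unit_vec comp_unit_dir ?fsvalP//.
case: i j => -[k b] i [[k' b'] j] /=; congr (_ %:R).
by rewrite !xpair_eqE/= (inj_eq val_inj) andbC [in RHS]andbC; do !case: (_ == _).
Qed.

Lemma unit_vec_norm (x : lp) : `|x| ^+ 2 = \sum_i inner (unit_vec i) x ^+ 2.
Proof.
rewrite -innerxx local_innerE big_seq_fsetE/=.
rewrite -(pair_bigA _ (fun kb j => inner (unit_vec (kb, j)) x ^+ 2))/=.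
rewrite -(pair_bigA _ (fun k b => \sum_j inner (unit_vec ((k, b), j)) x ^+ 2))/=.
apply: eq_bigr => k _; rewrite big_bool/=.
by congr (_ + _); apply: eq_bigr => j _; rewrite inner_unit_vec.
Qed.

Lemma comp_le b k j (x : lp) : `|comp b k j x| <= `|x|.
Proof.
have [kL|kL] := boolP (k \in L); last first.
  have /asboolP/(_ _ kL) xk := local_phaseP x.
  by rewrite /comp /momentum /position xk/=; case: b; rewrite mxE normr0.
rewrite -inner_unit_dir// -(@ler_pXn2r _ 2) ?nnegrE// real_normK ?num_real//.
rewrite unit_vec_norm (bigD1 ([` kL]%fset, b, j))//= lerDl.
by apply: sumr_ge0 => i _; exact: sqr_ge0.
Qed.

End Local.
End Coordinates.

(** * The Hamiltonian vector field in coordinates *)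

Section HamiltonianField.
Variables (R : realType) (d : nat) (G : choiceType).
Variables (m nu : G -> R) (V : G -> G -> 'rV[R]_d -> R).
Hypothesis V_smooth : forall k l, smooth (V k l).
Variable L : {fset G}.
Notation lp := (local_phase R d L).
Notation H := (hamiltonian m nu V (L := L)).
Implicit Types x : lp.

Lemma partial_is_derive k l j (w : 'rV[R]_d) :
  is_derive w 'e_j (V k l) (partial j (V k l) w).
Proof.
by have [_ /(_ j w) D] := V_smooth k l [::]; exact: derivableP.
Qed.

Lemma momentum_unit_dir k b (j : 'I_d) l : k \in L ->
  momentum (unit_dir R L k b j) l = ((l == k) && b)%:R *: 'e_j.
Proof.
move=> kL; rewrite /momentum/=; have [->|lk] := eqVneq l k.
  by rewrite kL; case: b; rewrite ?scale1r ?scale0r.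
by case: ifP; rewrite scale0r.
Qed.

Lemma position_unit_dir k b (j : 'I_d) l : k \in L ->
  position (unit_dir R L k b j) l = ((l == k) && ~~ b)%:R *: 'e_j.
Proof.
move=> kL; rewrite /position/=; have [->|lk] := eqVneq l k.
  by rewrite kL; case: b; rewrite ?scale1r ?scale0r.
by case: ifP; rewrite scale0r.
Qed.

(** A component of the gradient in [q_k] of the interaction, thus the physical force up to sign. The
    factor in front is the coefficient of [q_k] in [q_a - q_b]. *)
Definition force (k : G) (j : 'I_d) x : R :=
  \sum_(a <- L) \sum_(b <- L) ((a == k)%:R - (b == k)%:R) *
    partial j (V a b) (position x a - position x b).

(** Along the line [h *: v + x] the on-site terms are quadratic in [h] with linear coefficient [B],
    and the interaction depends on [h] only through a shift of [q_a - q_e] along ['e_j], with rate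
    [c a e]. *)
Lemma is_derive_hamiltonian x k b (j : 'I_d) : k \in L ->
  is_derive x (unit_dir R L k b j) H
    (if b then comp true k j x / m k else nu k * comp false k j x + force k j x).
Proof.
move=> kL; apply/is_derive_line; set v := unit_dir R L k b j.
have quad (u w : 'rV[R]_d) (h : R) : dotv (h *: u + w) (h *: u + w) =
    dotv u u * h ^+ 2 + (2 * dotv u w) * h + dotv w w.
  rewrite dotvDl dotvZl (dotvC u) (dotvC w) !dotvDl !dotvZl (dotvC w u); ring.
pose A l := dotv (momentum v l) (momentum v l) / (2 * m l) +
            nu l * dotv (position v l) (position v l) / 2.
pose B l := 2 * dotv (momentum v l) (momentum x l) / (2 * m l) +
            nu l * (2 * dotv (position v l) (position x l)) / 2.
pose D l := dotv (momentum x l) (momentum x l) / (2 * m l) +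
            nu l * dotv (position x l) (position x l) / 2.
pose c a e : R := ((a == k) && ~~ b)%:R - ((e == k) && ~~ b)%:R.
have -> : (fun h : R => H (h *: v + x)) = (fun h =>
    \sum_(l <- L) (A l * h ^+ 2 + B l * h + D l) +
    \sum_(a <- L) \sum_(e <- L)
      V a e ((c a e * h) *: 'e_j + (position x a - position x e))).
  apply/funext => h; rewrite /hamiltonian; congr (_ + _).
    apply: eq_bigr => l _.
    have -> : momentum (h *: v + x) l = h *: momentum v l + momentum x l by [].
    have -> : position (h *: v + x) l = h *: position v l + position x l by [].
    by rewrite !quad /A /B /D; ring.
  apply: eq_bigr => a _; apply: eq_bigr => e _; congr (V a e _).
  have pE l : position (h *: v + x) l = h *: position v l + position x l by [].
  rewrite !pE !position_unit_dir// !scalerA opprD addrACA -scalerBl; congr (_ *: _ + _).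
  by rewrite -mulrBr mulrC.
have -> : (if b then comp true k j x / m k else nu k * comp false k j x + force k j x) =
    \sum_(l <- L) B l + \sum_(a <- L) \sum_(e <- L)
      c a e * partial j (V a e) (position x a - position x e).
  have -> : \sum_(l <- L) B l =
      if b then comp true k j x / m k else nu k * comp false k j x.
    rewrite (big_fsetD1 k)//= big_seq big1 ?addr0 => [|l].
      rewrite /B momentum_unit_dir// position_unit_dir// eqxx !dotvZl !dotv_delta.
      rewrite /comp; by case: (b) => /=; rewrite invfM; move: (m k)^-1 => mi; field.
    by rewrite !inE => /andP[lk _]; rewrite /B momentum_unit_dir// position_unit_dir//
      (negPf lk) !scale0r !dotv0l !(mulr0, mul0r) addr0.
  rewrite /c; case: (b) => /=.
    rewrite big1 ?addr0// => a _; rewrite big1// => e _.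
    by rewrite !andbF subrr mul0r.
  congr (_ + _); apply: eq_bigr => a _; apply: eq_bigr => e _.
  by rewrite !andbT.
apply: is_deriveDf; apply: is_derive_bigsum => a.
  exact: is_derive_quadratic.
apply: is_derive_bigsum => e.
apply: (@is_derive_comp_scale _ (fun s => V a e (s *: 'e_j + (position x a - position x e)))).
by apply/is_derive_line; exact: partial_is_derive.
Qed.

Lemma field_momentum x k j : k \in L ->
  comp true k j (hamiltonian_field H x) = - (nu k * comp false k j x + force k j x).
Proof.
move=> kL; rewrite /comp /momentum /= kL /= /grad_q !mxE; congr (- _).
exact: (@derive_val _ _ _ _ _ _ _ (is_derive_hamiltonian x false j kL)).
Qed.

Lemma field_position x k j : k \in L ->
  comp false k j (hamiltonian_field H x) = comp true k j x / m k.
Proof.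
move=> kL; rewrite /comp /position /= kL /= /grad_p !mxE.
exact: (@derive_val _ _ _ _ _ _ _ (is_derive_hamiltonian x true j kL)).
Qed.

Lemma locally_lipschitz_comp_fun b k j : locally_lipschitz (fun x : lp => comp b k j x).
Proof.
move=> r; exists 1 => // x y _ _; rewrite mul1r -mulN1r -compZ -compD.
by rewrite scaleN1r; exact: (comp_le b k j (x - y)).
Qed.

Lemma locally_lipschitz_partial k l j : locally_lipschitz (partial j (V k l)).
Proof.
apply: C1_locally_lipschitz => [i w|i].
  by have [_] := V_smooth k l [:: j]; exact.
by have [] := V_smooth k l [:: i; j].
Qed.

Lemma locally_lipschitz_field i :
  locally_lipschitz (fun x => inner (unit_vec R i) (hamiltonian_field H x)).
Proof.
case: i => -[k b] j.
have posB a e : locally_lipschitz (fun x : lp => partial j (V a e) (position x a - position x e)).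
  apply: (@locally_lipschitz_comp _ _ _ (fun x : lp => position x a - position x e)
     (partial j (V a e)) 2); last exact: locally_lipschitz_partial.
  - move=> x y; apply: row_norm_le => [|i]; first exact: mulr_ge0.
    have -> : (position x a - position x e - (position y a - position y e)) 0 i =
       comp false a i (x - y) - comp false e i (x - y).
      by rewrite /comp /position /= !mxE; ring.
    rewrite (le_trans (ler_normB _ _))// mulr_natl mulr2n.
    by apply: lerD; exact: (comp_le false _ i (x - y)).
  - by rewrite /position /= subrr.
rewrite (_ : (fun _ => _) = fun x =>
  if b then - 1 * (nu (val k) * comp false (val k) j x + force (val k) j x)
  else (m (val k))^-1 * comp true (val k) j x); last first.
  apply/funext => x; rewrite inner_unit_vec/=; case: b.
    by rewrite field_momentum ?fsvalP// mulN1r.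
  by rewrite field_position ?fsvalP// mulrC.
case: b.
  apply: locally_lipschitzZ; apply: locally_lipschitzD.
    by apply: locally_lipschitzZ; exact: locally_lipschitz_comp_fun.
  apply: locally_lipschitz_sum => a; apply: locally_lipschitz_sum => e.
  by apply: locally_lipschitzZ; exact: posB.
by apply: locally_lipschitzZ; exact: locally_lipschitz_comp_fun.
Qed.

End HamiltonianField.

(** * Uniqueness of solutions of differential equations *)

Section OdeUniqueness.
Variables (R : realType) (X : innerProductType R) (I : finType) (e : I -> X).
Hypothesis e_norm : forall x, `|x| ^+ 2 = \sum_i inner (e i) x ^+ 2.

(** Both solutions are bounded on [[-|t|, |t|]], so one Lipschitz constant per coordinate is enough
    there. Gronwall's inequality for the squared distance, which vanishes at time 0, concludes. *)
Lemma ode_unique (F : X -> X) (y z : R -> X) :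
  (forall i, locally_lipschitz (fun x => inner (e i) (F x))) ->
  (forall t : R, is_derive t 1 y (F (y t))) ->
  (forall t : R, is_derive t 1 z (F (z t))) ->
  y 0 = z 0 -> y = z.
Proof.
move=> lF yF zF yz0; apply/funext => t.
have bnd (w : R -> X) : (forall t : R, is_derive t 1 w (F (w t))) ->
    exists r : R, forall s, `|s| <= `|t| -> `|w s| <= r.
  move=> wF; have /compact_bounded[r [_ rP]] : compact (w @` `[- `|t|, `|t|]).
    apply: continuous_compact; last exact: segment_compact.
    apply: continuous_subspaceT; exact: (is_derive_continuous wF).
  exists (r + 1) => s st; apply: rP; first by rewrite ltrDl.
  by exists s => //; rewrite /= in_itv/= -ler_norml.
have [ry yr] := bnd _ yF; have [rz zr] := bnd _ zF.
pose K i := s2val (cid2 (lF i (Num.max ry rz))).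
have K0 i : 0 <= K i by exact: (s2valP (cid2 (lF i (Num.max ry rz)))).
have KP s i : `|s| <= `|t| ->
    `|inner (e i) (F (y s)) - inner (e i) (F (z s))| <= K i * `|y s - z s|.
  move=> st; apply: (s2valP' (cid2 (lF i (Num.max ry rz)))).
    by rewrite le_max yr.
  by rewrite le_max zr// orbT.
pose c i s := inner (e i) (y s) - inner (e i) (z s).
pose dc i s := inner (e i) (F (y s)) - inner (e i) (F (z s)).
have cD i (s : R) : is_derive s 1 (c i) (dc i s).
  apply: is_deriveDf; first exact: is_derive_inner.
  by apply: is_deriveN; exact: is_derive_inner.
have uE s : \sum_i c i s ^+ 2 = `|y s - z s| ^+ 2.
  by rewrite e_norm; apply: eq_bigr => i _; rewrite innerBr.
have uD (s : R) : is_derive s 1 (fun s => \sum_i c i s ^+ 2) (\sum_i 2 * c i s * dc i s).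
  by apply: is_derive_bigsum => i; exact: is_derive_sqr.
have ub s : `|s| <= `|t| ->
    `|\sum_i 2 * c i s * dc i s| <= (\sum_i 2 * K i) * \sum_i c i s ^+ 2.
  move=> st; rewrite uE mulr_suml (le_trans (ler_norm_sum _ _ _))// ler_sum// => i _.
  rewrite !normrM (@ger0_norm _ 2)// -!mulrA ler_wpM2l// expr2 mulrCA.
  apply: ler_pM => //; last exact: KP.
  rewrite -(@ler_pXn2r _ 2) ?nnegrE// real_normK ?num_real// -uE (bigD1 i)//= lerDl.
  by apply: sumr_ge0 => j _; exact: sqr_ge0.
have := gronwall uD ub (lexx _).
rewrite !uE yz0 subrr normr0 expr0n mulr0 => yz.
by apply/eqP; rewrite -subr_eq0 -normr_eq0 -sqrf_eq0 eq_le yz sqr_ge0.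
Qed.

Lemma is_derive_shift (W : normedModType R) (f : R -> W) (s t : R) D :
  is_derive (s + t) 1 f D -> is_derive s 1 (fun h => f (h + t)) D.
Proof.
move=> fD; have := @is_derive_line_at _ _ _ t 1 f D s.
rewrite (_ : (fun h => f (h *: 1 + t)) = fun h => f (h + t)); last first.
  by apply/funext => h; rewrite /GRing.scale/= mulr1.
by apply; rewrite /GRing.scale/= mulr1.
Qed.

End OdeUniqueness.

(** On the left stands the time derivative of [a ^+ 2 + c ^+ 2] for a momentum component [a],
    position component [c], interaction gradient [e] and inverse mass [mi]. The products are bounded
    by half sums of squares. *)
Lemma energy_estimate (R : realType) (nu mi M a c e : R) : 0 <= nu -> 0 <= mi ->
  `|e| <= M ->
  `|2 * a * - (nu * c + e) + 2 * c * (a * mi)| <=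
  (nu + 1 + mi) * (a ^+ 2 + c ^+ 2) + M ^+ 2.
Proof.
move=> nu0 mi0 eM; have e2 : e ^+ 2 <= M ^+ 2.
  by rewrite -real_normK ?num_real// lerXn2r ?nnegrE// (le_trans _ eM).
have a2 := sqr_ge0 a; have c2 := sqr_ge0 c.
have h1 := mulr_ge0 nu0 (sqr_ge0 (a - c)); have h2 := mulr_ge0 nu0 (sqr_ge0 (a + c)).
have h3 := mulr_ge0 mi0 (sqr_ge0 (a - c)); have h4 := mulr_ge0 mi0 (sqr_ge0 (a + c)).
have h5 := sqr_ge0 (a - e); have h6 := sqr_ge0 (a + e).
by rewrite ler_norml; apply/andP; split; lra.
Qed.

(** * Group law of the flow and displacement of a single site *)

Section Flow.
Variables (R : realType) (d : nat) (G : choiceType).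
Variables (m nu : G -> R) (V : G -> G -> 'rV[R]_d -> R).
Hypothesis V_smooth : forall k l, smooth (V k l).
Variable L : {fset G}.
Notation lp := (local_phase R d L).
Notation H := (hamiltonian m nu V (L := L)).
Variable Phi : R -> lp -> lp.
Hypothesis Phi_flow : is_hamiltonian_flow H Phi.

(** As functions of [s], both sides solve the same equation with value [Phi t x] at 0. *)
Lemma flowD s t x : Phi (s + t) x = Phi s (Phi t x).
Proof.
have [P0 PD] := Phi_flow x; have [Q0 QD] := Phi_flow (Phi t x).
have := @ode_unique R lp _ _ (@unit_vec_norm R d G L) (hamiltonian_field H)
  (fun s => Phi (s + t) x) (fun s => Phi s (Phi t x)).
move=> h; apply: (congr1 (fun f => f s) (h _ _ _ _)).
- by move=> i; exact: locally_lipschitz_field.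
- by move=> r; have := @is_derive_shift R lp (fun s => Phi s x) r t _ (PD (r + t)).
- by rewrite add0r Q0.
Qed.

Lemma is_derive_flow_comp b k j x (t : R) : k \in L ->
  is_derive t 1 (fun s => comp b k j (Phi s x)) (comp b k j (hamiltonian_field H (Phi t x))).
Proof.
move=> kL; have [_ PD] := Phi_flow x.
have := is_derive_inner (unit_dir R L k b j) (PD t).
rewrite inner_unit_dir// (_ : (fun s => _) = fun s => comp b k j (Phi s x))//.
by apply/funext => s; rewrite inner_unit_dir.
Qed.

(** The added 1 absorbs the constant term of the energy estimate, so that Gronwall's inequality
    applies in homogeneous form, and lets the quantity dominate each component itself. *)
Definition site_energy (k : G) (x : phase R d G) : R :=
  1 + \sum_j (comp true k j x ^+ 2 + comp false k j x ^+ 2).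

(* Depends on [L] only through a bound [M] on the force at the site [k]: this makes
   the continuity in time uniform in the volume. *)
Definition site_speed (k : G) (M : R) : R :=
  (nu k + M + (m k)^-1) * expR (nu k + 1 + (m k)^-1 + d%:R * M ^+ 2).

Lemma comp_site_energy b k j (x : phase R d G) : `|comp b k j x| <= site_energy k x.
Proof.
rewrite /site_energy (bigD1 j)//=; set S := \sum_(i < d | _) _.
have S0 : 0 <= S by apply: sumr_ge0 => i _; rewrite addr_ge0 ?sqr_ge0.
have c1 (a : R) : `|a| <= 1 + a ^+ 2.
  by rewrite -[a ^+ 2]real_normK ?num_real//; have := sqr_ge0 (`|a| - 1); nra.
have := sqr_ge0 (comp true k j x); have := sqr_ge0 (comp false k j x).
by have := c1 (comp b k j x); case: b; lra.
Qed.

Lemma site_energy_ge1 k (x : phase R d G) : 1 <= site_energy k x.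
Proof.
by rewrite lerDl; apply: sumr_ge0 => i _; rewrite addr_ge0 ?sqr_ge0.
Qed.

(** Gronwall's inequality bounds the site energy during the motion by [expR K] times its initial
    value. This bounds the velocity of the site, and the mean value inequality bounds its
    displacement. *)
Lemma flow_displacement k M b j x t :
  k \in L -> 0 < m k -> 0 < nu k ->
  (forall i y, `|force V k i (y : lp)| <= M) -> `|t| <= 1 ->
  `|comp b k j (Phi t x) - comp b k j x| <= site_speed k M * site_energy k x * `|t|.
Proof.
move=> kL mk nuk fM t1.
have M0 : 0 <= M by exact: le_trans (fM j x).
have mk0 : 0 < (m k)^-1 by rewrite invr_gt0.
set mi := (m k)^-1 in mk0.
pose p i s := comp true k i (Phi s x); pose q i s := comp false k i (Phi s x).
pose f i s := force V k i (Phi s x).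
have pD i (s : R) : is_derive s 1 (p i) (- (nu k * q i s + f i s)).
  by rewrite /q /f -(field_momentum m nu V_smooth)//; exact: is_derive_flow_comp.
have qD i (s : R) : is_derive s 1 (q i) (p i s * mi).
  by rewrite /p -(field_position m nu V_smooth)//; exact: is_derive_flow_comp.
have uD (s : R) : is_derive s 1 (fun s => site_energy k (Phi s x))
    (\sum_i (2 * p i s * - (nu k * q i s + f i s) + 2 * q i s * (p i s * mi))).
  have S : is_derive s 1 (fun s => \sum_i (p i s ^+ 2 + q i s ^+ 2))
      (\sum_i (2 * p i s * - (nu k * q i s + f i s) + 2 * q i s * (p i s * mi))).
    by apply: is_derive_bigsum => i; apply: is_deriveDf; apply: is_derive_sqr.
  by have := is_deriveDf (@is_derive_cst R R R 1 s 1) S; rewrite add0r.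
(* Each of the [d] components contributes a constant [M ^+ 2], absorbed since the site energy is at
   least 1. *)
set K := nu k + 1 + mi + d%:R * M ^+ 2.
have dM : 0 <= d%:R * M ^+ 2 by rewrite mulr_ge0// sqr_ge0.
have K0 : 0 <= K by rewrite /K; lra.
have ub s : `|s| <= 1 ->
    `|\sum_i (2 * p i s * - (nu k * q i s + f i s) + 2 * q i s * (p i s * mi))| <=
    K * site_energy k (Phi s x).
  move=> _; rewrite (le_trans (ler_norm_sum _ _ _))//.
  apply: (@le_trans _ _ (\sum_(i < d) ((nu k + 1 + mi) * (p i s ^+ 2 + q i s ^+ 2) + M ^+ 2))).
    apply: ler_sum => i _.
    by apply: energy_estimate; [exact: ltW|exact: ltW|exact: fM].
  rewrite big_split/= -mulr_sumr sumr_const card_ord -mulr_natl /site_energy.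
  set S := \sum_(i < d) _.
  have S0 : 0 <= S by apply: sumr_ge0 => i _; rewrite addr_ge0 ?sqr_ge0.
  by rewrite /K -/S; nra.
have x0 : Phi 0 x = x by have [] := Phi_flow x.
have uE s : `|s| <= `|t| -> site_energy k (Phi s x) <= expR K * site_energy k x.
  move=> st; have s1 := le_trans st t1.
  have := gronwall uD ub s1; rewrite x0 => /le_trans; apply.
  rewrite ler_pM2r ?ler_expR; last exact: lt_le_trans (site_energy_ge1 k x).
  by rewrite ler_piMr.
have speed i s : `|s| <= `|t| ->
    `|comp i k j (hamiltonian_field H (Phi s x))| <= site_speed k M * site_energy k x.
  move=> /uE st; rewrite /site_speed -/mi -/K -mulrA.
  apply: (@le_trans _ _ ((nu k + M + mi) * site_energy k (Phi s x))); last first.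
    by rewrite ler_wpM2l// !addr_ge0// ltW.
  have E1 := site_energy_ge1 k (Phi s x).
  case: i.
    rewrite (field_momentum m nu V_smooth)// normrN (le_trans (ler_normD _ _))//.
    rewrite normrM (gtr0_norm nuk).
    have := comp_site_energy false k j (Phi s x); have := fM j (Phi s x); nra.
  rewrite (field_position m nu V_smooth)// normrM -/mi (gtr0_norm mk0).
  have := comp_site_energy true k j (Phi s x); nra.
have := @mean_value_le R (fun s => comp b k j (Phi s x))
  (fun s => comp b k j (hamiltonian_field H (Phi s x))) (site_speed k M * site_energy k x) t.
rewrite x0; apply; last exact: speed.
by move=> s _; exact: is_derive_flow_comp.
Qed.

End Flow.

(** * Bounds on the force that are uniform in the volume *)

Section ForceBound.
Variables (R : realType) (d : nat) (G : choiceType).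
Variables (V : G -> G -> 'rV[R]_d -> R) (C : R) (Cc : G -> G -> R).
Hypotheses (V_sym : forall k l x, V k l x = V l k (- x))
  (V_smooth : forall k l, smooth (V k l)) (C_ge0 : 0 <= C)
  (Cc_ge0 : forall k l, 0 <= Cc k l)
  (V_bound : forall k l (beta : 'I_d -> nat) x,
     `|mpartial beta (V k l) x| <= Cc k l * C ^+ (\sum_(j < d) beta j)%N)
  (Cc_sup : (ereal_sup [set \esum_(l in [set: G]) (Cc k l)%:E
                       | k in [set: G]] < +oo)%E).

Lemma mpartial_single j (f : 'rV[R]_d -> R) :
  mpartial (fun i => (i == j) : nat) f = partial j f.
Proof.
rewrite /mpartial; have := enum_uniq 'I_d; have := mem_enum 'I_d j.
have none (s : seq 'I_d) : j \notin s ->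
    foldr (fun i => iter (i == j) (partial i)) f s = f.
  elim: s => //= i s IH; rewrite inE negb_or => /andP[ji /IH ->].
  by rewrite eq_sym (negPf ji).
elim: (enum _) => //= i s IH; rewrite inE => ijs /andP[si us].
have [ij|ij] := eqVneq i j; first by rewrite ij in si *; rewrite none.
by rewrite /= IH//; move: ijs; rewrite eq_sym (negPf ij).
Qed.

Lemma partial_bound k l j x : `|partial j (V k l) x| <= Cc k l * C.
Proof.
rewrite -mpartial_single (le_trans (V_bound _ _ _ _))//.
rewrite (bigD1 j)//= eqxx big1 ?addn0 ?expr1// => i /negPf ->.
by [].
Qed.

(** Transfers bounds from the pairs [(k, l)] to the pairs [(l, k)]: the coefficients are summable in
    their second index. *)
Lemma partial_sym k l j x : partial j (V k l) x = - partial j (V l k) (- x).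
Proof.
apply: (@derive_val _ _ _ _ _ _ _ _); apply/is_derive_line.
rewrite (_ : (fun _ => _) = fun h : R => V l k (- h *: 'e_j + - x)); last first.
  by apply/funext => h; rewrite V_sym opprD scaleNr.
apply: (@is_derive_opp _ (fun h => V l k (h *: 'e_j + - x))).
by rewrite oppr0; apply/is_derive_line; exact: partial_is_derive.
Qed.

Lemma summable_coefficients k : exists S : R, forall L : {fset G},
  \sum_(l <- L) Cc k l <= S.
Proof.
have sup_k : (\esum_(l in [set: G]) (Cc k l)%:E < +oo)%E.
  by apply: le_lt_trans Cc_sup; apply: ereal_sup_ubound; exists k.
have sum_le (L : {fset G}) : ((\sum_(l <- L) Cc k l)%:E <= \esum_(l in [set: G]) (Cc k l)%:E)%E.
  rewrite -sumEFin; apply: ereal_sup_ubound; exists [set` L] => /=.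
    by split => //; exact: finite_fset.
  by rewrite fsbig_finite ?finite_fset// set_fsetK.
exists (fine (\esum_(l in [set: G]) (Cc k l)%:E)) => L.
rewrite -lee_fin fineK// ge0_fin_numE//.
by apply: esum_ge0 => l _; rewrite lee_fin.
Qed.

(** Only pairs containing [k] contribute. The row and the column of [k] are each bounded by [S * C],
    where [S] bounds all finite sums of the coefficients and hence does not depend on [L]. *)
Lemma force_bound k : exists M : R, forall (L : {fset G}) j (x : local_phase R d L),
  k \in L -> `|force V k j x| <= M.
Proof.
have [S SP] := summable_coefficients k.
exists (S * C + S * C) => L j x kL.
pose P a b := partial j (V a b) (position x a - position x b).
have Pl b : `|P k b| <= Cc k b * C by exact: partial_bound.
have Pr a : `|P a k| <= Cc k a * C by rewrite /P partial_sym normrN; exact: partial_bound.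
have -> : force V k j x = \sum_(b <- L) P k b - \sum_(a <- L) P a k.
  rewrite /force; under eq_bigr do under eq_bigr do rewrite mulrBl.
  under eq_bigr do rewrite sumrB; rewrite sumrB; congr (_ - _).
    rewrite [LHS](big_fsetD1 k)//= [X in _ + X]big_seq [X in _ + X]big1 ?addr0 => [|a].
      by apply: eq_bigr => b _; rewrite eqxx mul1r.
    by rewrite !inE => /andP[/negPf ak _]; rewrite big1// => b _; rewrite ak mul0r.
  apply: eq_bigr => a _; rewrite [LHS](big_fsetD1 k)//= [X in _ + X]big_seq
    [X in _ + X]big1 ?addr0 => [|b].
    by rewrite eqxx mul1r.
  by rewrite !inE => /andP[/negPf bk _]; rewrite bk mul0r.
rewrite (le_trans (ler_normB _ _))//; apply: lerD.
all: rewrite (le_trans (ler_norm_sum _ _ _))//.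
all: apply: (@le_trans _ _ (\sum_(b <- L) Cc k b * C)); first exact: ler_sum.
all: by rewrite -mulr_suml ler_wpM2r.
Qed.

End ForceBound.

(** * The infinite-volume dynamics *)

Section StarContraction.
Variable R : realType.

(** Collects what automorphisms and pullbacks along maps have in common. No target algebra is
    prescribed, so the finite-volume evolutions are instances on all of [CR]. *)
Record star_contraction (X Y : topologicalType) (A : set (X -> R[i]))
    (a : (X -> R[i]) -> (Y -> R[i])) : Prop := {
  star_ctrD : forall f g, A f -> A g -> a (fun x => f x + g x) = (fun y => a f y + a g y);
  star_ctrZ : forall c f, A f -> a (fun x => c * f x) = (fun y => c * a f y);
  star_ctrM : forall f g, A f -> A g -> a (fun x => f x * g x) = (fun y => a f y * a g y);
  star_ctrJ : forall f, A f -> a (fun x => (f x)^*) = (fun y => (a f y)^*);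
  star_ctr_le : forall f (c : R[i]), A f -> 0 <= c -> (forall x, `|f x| <= c) ->
    forall y, `|a f y| <= c }.

Lemma star_contraction_pullback (X Y : topologicalType) (A : set (X -> R[i])) (h : Y -> X) :
  star_contraction A (fun f => f \o h).
Proof. by split=> // f c _ _ fc y; exact: fc. Qed.

Lemma star_automorphism_contraction (X : topologicalType) (A : set (X -> R[i])) a :
  Cstar_subalgebra A -> A (fun=> 1) -> star_automorphism A a -> star_contraction A a.
Proof.
move=> AA A1 aA; split.
- exact: star_autD.
- exact: star_autZ.
- exact: star_autM.
- exact: star_autJ.
- by move=> f c Af c0 fc; exact: (star_automorphism_le AA A1).
Qed.

Section Theory.
Variables (X Y : topologicalType) (A : set (X -> R[i])).
Hypothesis AA : Cstar_subalgebra A.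

Lemma star_ctrB a f g : star_contraction (Y := Y) A a -> A f -> A g ->
  a (fun x => f x - g x) = (fun y => a f y - a g y).
Proof.
move=> aA Af Ag.
have Ng : A (fun x => -1 * g x) by exact: (CstarZ AA).
rewrite (_ : (fun x => f x - g x) = fun x => f x + -1 * g x).
  by rewrite (star_ctrD aA Af Ng) (star_ctrZ aA)//; apply/funext => y; rewrite mulN1r.
by apply/funext => x; rewrite mulN1r.
Qed.

Lemma star_ctr_dist a f g (e : R[i]) : star_contraction (Y := Y) A a -> A f -> A g ->
  0 <= e -> (forall x, `|f x - g x| <= e) -> forall y, `|a f y - a g y| <= e.
Proof.
move=> aA Af Ag e0 fg y.
have := star_ctr_le aA (CstarB AA Af Ag) e0 fg y.
by rewrite (star_ctrB aA).
Qed.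

(** Reduces the inclusion of the image of a generated algebra in [D] to its generators. Closedness
    comes from contractivity. *)
Lemma Cstar_preimage (D : set (Y -> R[i])) a : Cstar_subalgebra D ->
  star_contraction A a -> Cstar_subalgebra [set f | A f /\ D (a f)].
Proof.
move=> DD aA; split.
- by move=> f [Af _]; exact: (Cstar_Cb AA).
- split; first exact: Cstar0.
  rewrite (_ : (fun=> 0) = fun x : X => 0 * (fun=> 0) x); last by apply/funext => x; rewrite mul0r.
  rewrite (star_ctrZ aA); last exact: Cstar0.
  rewrite (_ : (fun _ => _) = fun=> 0); first exact: Cstar0.
  by apply/funext => x; rewrite mul0r.
- move=> f g [Af Df] [Ag Dg]; split; first exact: (CstarD AA).
  by rewrite (star_ctrD aA)//; exact: (CstarD DD).
- move=> c f [Af Df]; split; first exact: (CstarZ AA).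
  by rewrite (star_ctrZ aA)//; exact: (CstarZ DD).
- move=> f g [Af Df] [Ag Dg]; split; first exact: (CstarM AA).
  by rewrite (star_ctrM aA)//; exact: (CstarM DD).
- move=> f [Af Df]; split; first exact: (CstarJ AA).
  by rewrite (star_ctrJ aA)//; exact: (CstarJ DD).
- apply/closed_uniformP => f fB.
  have Af : A f.
    have /closed_uniformP := Cstar_closed AA; apply => e /fB[g [Ag _] fg].
    by exists g.
  split => //; have /closed_uniformP := Cstar_closed DD; apply => e e0.
  have e2 : 0 < e / 2 by rewrite divr_gt0.
  have [g [Ag Dg] fg] := fB _ e2; exists (a g) => // y.
  apply: (@le_lt_trans _ _ (e / 2)); last by rewrite ltr_pdivrMr// ltr_pMr// ltr1n.
  by apply: (star_ctr_dist aA) => // [|x]; exact: ltW.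
Qed.

(** Reduces uniform convergence of [b] to [a] on an algebra to its generators. It serves twice: for
    the infinite-volume limit and for the limit of small times. *)
Lemma Cstar_cvg (T : Type) (F : set_system T) (FF : Filter F)
    (b : T -> (X -> R[i]) -> (Y -> R[i])) (a : (X -> R[i]) -> (Y -> R[i])) :
  (forall f, A f -> exists2 M : R, 0 < M & forall y, `|a f y| <= M%:C%C) ->
  star_contraction A a -> (forall t, star_contraction A (b t)) ->
  Cstar_subalgebra [set f | A f /\ forall e : R[i], 0 < e ->
    \forall t \near F, forall y, `|a f y - b t f y| < e].
Proof.
move=> abd aA bA; split.
- by move=> f [Af _]; exact: (Cstar_Cb AA).
- split; first exact: Cstar0.
  move=> e e0; apply: filterE => t y.
  have le0 c : star_contraction (Y := Y) A c -> c (fun=> 0) y = 0.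
    move=> cA; apply/eqP; rewrite -normr_eq0 eq_le normr_ge0 andbT.
    by apply: (star_ctr_le cA) => [||x]; [exact: Cstar0| |rewrite normr0].
  by rewrite !le0// subrr normr0.
- move=> f g [Af fab] [Ag gab]; split; first exact: (CstarD AA).
  move=> e e0; have e2 : 0 < e / 2 by rewrite divr_gt0.
  move: (fab _ e2) (gab _ e2); apply: filterS2 => t ft gt y.
  rewrite (star_ctrD aA)// (star_ctrD (bA t))// opprD addrACA [e]splitr.
  by rewrite (le_lt_trans (ler_normD _ _))// ltrD.
- move=> c f [Af fab]; split; first exact: (CstarZ AA).
  move=> e e0; have c1 : 0 < `|c| + 1 by rewrite ltr_wpDl.
  have ec : 0 < e / (`|c| + 1) by rewrite divr_gt0.
  move: (fab _ ec); apply: filterS => t ft y.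
  rewrite (star_ctrZ aA)// (star_ctrZ (bA t))// -mulrBr normrM.
  apply: (@le_lt_trans _ _ ((`|c| + 1) * `|a f y - b t f y|)).
    by rewrite ler_wpM2r// lerDl.
  by rewrite mulrC -ltr_pdivlMr.
- move=> f g [Af fab] [Ag gab]; split; first exact: (CstarM AA).
  move=> e e0; have [M M0 fM] := abd _ Af.
  have [_ /bounded_funP[N N0 gN]] := Cstar_Cb AA Ag.
  have MC : 0 < M%:C%C :> R[i] by rewrite ltcR.
  have NC : 0 < N%:C%C :> R[i] by rewrite ltcR.
  have e2 : 0 < e / 2 by rewrite divr_gt0.
  move: (fab _ (divr_gt0 e2 NC)) (gab _ (divr_gt0 e2 MC)); apply: filterS2 => t ft gt y.
  rewrite (star_ctrM aA)// (star_ctrM (bA t))//.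
  (* Split so that only [a f], bounded by [abd], and [b t g], bounded by contractivity, multiply the
     differences. *)
  have -> : a f y * a g y - b t f y * b t g y =
    (a g y - b t g y) * a f y + (a f y - b t f y) * b t g y by ring.
  have bg : `|b t g y| <= N%:C%C by apply: (star_ctr_le (bA t)) => //; exact: ltW.
  rewrite [e]splitr (le_lt_trans (ler_normD _ _))// !normrM; apply: ltrD.
    apply: (@le_lt_trans _ _ (`|a g y - b t g y| * M%:C%C)); first by rewrite ler_wpM2l.
    by rewrite -ltr_pdivlMr.
  apply: (@le_lt_trans _ _ (`|a f y - b t f y| * N%:C%C)); first by rewrite ler_wpM2l.
  by rewrite -ltr_pdivlMr.
- move=> f [Af fab]; split; first exact: (CstarJ AA).
  move=> e e0; move: (fab _ e0); apply: filterS => t ft y.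
  by rewrite (star_ctrJ aA)// (star_ctrJ (bA t))// -rmorphB norm_conjC.
- apply/closed_uniformP => f fB.
  have Af : A f.
    have /closed_uniformP := Cstar_closed AA; apply => e /fB[g [Ag _] fg].
    by exists g.
  split => // e e0; have e4 : 0 < e / 2 / 2 by rewrite !divr_gt0.
  have e2 : 0 < e / 2 by rewrite divr_gt0.
  have [g [Ag gab] fg] := fB _ e4.
  have fg' x : `|f x - g x| <= e / 2 / 2 by exact: ltW.
  move: (gab _ e2); apply: filterS => t gt y.
  have -> : a f y - b t f y = (a g y - b t g y) + ((a f y - a g y) - (b t f y - b t g y)) by ring.
  rewrite [e]splitr (le_lt_trans (ler_normD _ _))// ltr_leD//.
  rewrite [leRHS]splitr (le_trans (ler_normB _ _))// lerD//.
    by apply: (star_ctr_dist aA) => //; exact: ltW.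
  by apply: (star_ctr_dist (bA t)) => //; exact: ltW.
Qed.

End Theory.
End StarContraction.

(** * Local observables inside the resolvent algebra *)

Section Projection.
Variables (R : realType) (d : nat) (G : choiceType) (L : {fset G}).

Lemma inner_phase_proj (x : local_phase R d L) (y : phase R d G) :
  inner x (phase_proj L y) = inner (x : phase R d G) y.
Proof.
have := proj_orthogonal y x; rewrite innerC innerBr => /eqP.
by rewrite subr_eq0 => /eqP ->.
Qed.

Lemma comp_phase_proj b k j (x : phase R d G) : k \in L ->
  comp b k j (phase_proj L x) = comp b k j x.
Proof. by move=> kL; rewrite /comp /momentum /position /= kL. Qed.

(** The projection is orthogonal, so local resolvents pull back to resolvents; [Cstar_preimage] does
    the rest. *)
Lemma CR_phase_proj f : CR (local_phase R d L) f -> CR (phase R d G) (f \o phase_proj L).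
Proof.
pose B := [set f | Cb R (local_phase R d L) f /\ CR (phase R d G) (f \o phase_proj L)].
have BB : Cstar_subalgebra B.
  apply: Cstar_preimage.
  - exact: Cstar_subalgebra_Cb.
  - exact: Cstar_subalgebra_CR.
  - exact: star_contraction_pullback.
suff: CR (local_phase R d L) `<=` B by move=> h /h[].
apply: Cstar_gen_sub => // h [x [lam l0 ->]]; split; first exact: resolvent_Cb.
rewrite (_ : _ \o _ = resolvent_fun (x : phase R d G) lam); first exact: CR_resolvent.
by apply/funext => y; rewrite /resolvent_fun /= inner_phase_proj.
Qed.

Lemma CR_C0_phase_proj g : C0 R (local_phase R d L) g ->
  CR (phase R d G) (g \o phase_proj L).
Proof.
move=> gC; apply: CR_phase_proj.
exact: (CR_C0 (@unit_vec_orthonormal R d G L) (@unit_vec_norm R d G L)).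
Qed.

End Projection.

(** Take for [L] the support of [x]. Thus [CR] is generated by local observables, on which the
    dynamics is given as a limit. *)
Lemma resolvent_local (R : realType) (d : nat) (G : choiceType) (x : phase R d G) lam :
  exists (L : {fset G}) (x' : local_phase R d L),
  resolvent_fun x lam = resolvent_fun x' lam \o phase_proj L.
Proof.
have fx : finite_set [set k | x k != 0] by apply/asboolP; exact: phase_fin_supp.
exists (fset_set [set k | x k != 0]), (phase_proj _ x).
apply/funext => y; rewrite /resolvent_fun/= inner_phase_proj.
rewrite (_ : phase_of_local _ = x)//; apply/val_inj/funext => k /=.
rewrite in_fset_set//; case: ifPn => //; rewrite notin_setE/= => /negP.
by rewrite negbK => /eqP ->.
Qed.

#[local] Existing Instance summability.totally_filter.

(** * Group law, invariance and strong continuity of the limit dynamics *)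

Section InfiniteVolume.
Variables (R : realType) (d : nat) (G : choiceType).
Variables (m nu : G -> R) (V : G -> G -> 'rV[R]_d -> R).
Hypotheses (m_gt0 : forall k, 0 < m k) (nu_gt0 : forall k, 0 < nu k)
  (V_smooth : forall k l, smooth (V k l)).
Variable M : G -> R.
Hypothesis force_le : forall k (L : {fset G}) j (x : local_phase R d L),
  k \in L -> `|force V k j x| <= M k.
Variable Phi : forall L : {fset G}, R -> local_phase R d L -> local_phase R d L.
Arguments Phi : clear implicits.
Hypothesis Phi_flow : forall L : {fset G},
  is_hamiltonian_flow (hamiltonian m nu V (L := L)) (Phi L).
Variable alpha : R -> (phase R d G -> R[i]) -> (phase R d G -> R[i]).
Hypothesis alpha_dyn : is_infinite_volume_dynamics Phi alpha.

Notation A := (CR (phase R d G)).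
Let AA : Cstar_subalgebra A := Cstar_subalgebra_CR _.
Let A1 : A (fun=> 1) := CR_cst 1.
Implicit Types f g : phase R d G -> R[i].

Lemma evolution_contraction t : star_contraction A (alpha t).
Proof. by apply: star_automorphism_contraction => //; case: (alpha_dyn t). Qed.

Lemma evolution_CR t f : A f -> A (alpha t f).
Proof. by move=> Af; have [aA _] := alpha_dyn t; have [h _ _] := star_aut_bij aA; exact: h. Qed.

Lemma CR_bounded f : A f -> exists2 N : R, 0 < N & forall x, `|f x| <= N%:C%C.
Proof. by move=> Af; have [_ /bounded_funP] := Cstar_Cb AA Af. Qed.

Lemma local_evolution_cvg t f : A f -> forall e : R[i], 0 < e ->
  \forall L \near summability.totally, forall x,
    `|alpha t f x - local_evolution Phi L t f x| < e.
Proof.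
pose B := [set f | A f /\ forall e : R[i], 0 < e ->
  \forall L \near summability.totally, forall x,
    `|alpha t f x - local_evolution Phi L t f x| < e].
suff : A `<=` B by move=> AB /AB[].
have BB : Cstar_subalgebra B.
  apply: (@Cstar_cvg _ _ _ _ AA _ summability.totally _
            (fun L => local_evolution Phi L t)).
  - by move=> g Ag; apply: CR_bounded; exact: evolution_CR.
  - exact: evolution_contraction.
  - move=> L; apply: (star_contraction_pullback A (fun x => Phi L t (phase_proj L x) : phase R d G)).
apply: Cstar_gen_sub => // h [x [lam l0 ->]]; split; first exact: CR_resolvent.
have [L0 [x' ->]] := resolvent_local x lam.
have [_ /(_ L0 (resolvent_fun x' lam) (CR_resolvent _ l0)) h'] := alpha_dyn t.
by apply/cvg_uniformP.
Qed.

Lemma evolutionD s t f : A f -> alpha (s + t) f = alpha s (alpha t f).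
Proof.
move=> Af; apply/funext => x; apply/eqP; rewrite -subr_eq0 -normr_le0.
apply/ler_addgt0Pl => e e0; rewrite addr0.
have e3 : 0 < e / 3%:R by rewrite divr_gt0.
(* A single volume [L] serves three approximations. Uniformity in the phase point matters, since the
   second one is used at [z], which depends on [L]. *)
have := filter_ex (filterI (local_evolution_cvg (s + t) Af e3)
  (filterI (local_evolution_cvg t Af e3) (local_evolution_cvg s (evolution_CR t Af) e3))).
case=> L [h1 [h2 h3]].
set z : phase R d G := Phi L s (phase_proj L x).
have zE : local_evolution Phi L (s + t) f x = local_evolution Phi L t f z.
  by rewrite /local_evolution addrC (flowD V_smooth (@Phi_flow L)) Defs.projK.
rewrite (_ : _ - _ = (alpha (s + t) f x - local_evolution Phi L (s + t) f x) +
   ((local_evolution Phi L t f z - alpha t f z) +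
    (local_evolution Phi L s (alpha t f) x - alpha s (alpha t f) x))); last first.
  by rewrite zE /local_evolution -/z; ring.
have -> : e = e / 3%:R + (e / 3%:R + e / 3%:R) by rewrite -!mulrDl; field.
rewrite (le_trans (ler_normD _ _))// lerD//; first exact: ltW.
by rewrite (le_trans (ler_normD _ _))// lerD// distrC ltW.
Qed.

(** By the group law [alpha 0] is idempotent, and it is injective. *)
Lemma evolution0 f : A f -> alpha 0 f = f.
Proof.
move=> Af; have [aA _] := alpha_dyn 0; have [_ inj _] := star_aut_bij aA.
apply: (inj _ _ (mem_set (evolution_CR 0 Af)) (mem_set Af)).
by rewrite -evolutionD// addr0.
Qed.

Lemma evolutionK t f : A f -> alpha t (alpha (- t) f) = f.
Proof. by move=> Af; rewrite -evolutionD// subrr evolution0. Qed.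

Lemma evolution_cst t c : alpha t (fun=> c) = fun=> c.
Proof.
have [aA _] := alpha_dyn t.
rewrite (_ : (fun=> c) = fun x : phase R d G => c * (fun=> 1) x); last first.
  by apply/funext => x; rewrite mulr1.
by rewrite (star_autZ aA)// (star_automorphism1 A1 aA).
Qed.

Lemma frakK_loc_CR L f : frakK_loc L f -> A f.
Proof. by case=> g gC <-; exact: CR_C0_phase_proj. Qed.

Lemma frakK_CR f : frakK R d G f -> A f.
Proof.
case=> g Kg [c ->]; apply: (CstarD AA); last exact: CR_cst.
move: Kg; apply: Cstar_gen_sub => // h [L _]; exact: frakK_loc_CR.
Qed.

Lemma frakL_CR f : frakL alpha f -> A f.
Proof.
apply: Cstar_gen_sub => // h [t _ [g Kg <-]]; apply: evolution_CR; exact: frakK_CR.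
Qed.

(** The neighbourhood of 0 is fixed before [L], which is the uniformity needed to pass to infinite
    volume. *)
Lemma local_evolution_continuous0 L0 (g : local_phase R d L0 -> R[i]) (e : R[i]) :
  C0 R (local_phase R d L0) g -> 0 < e ->
  \forall t \near (0 : R), forall L : {fset G}, (L0 `<=` L)%fset -> forall x,
    `|g (phase_proj L0 x) - g (phase_proj L0 (Phi L t (phase_proj L x)))| < e.
Proof.
move=> [cg g0] e0; have e2 : 0 < e / 2 by rewrite divr_gt0.
have [B cB gB] := g0 _ e2.
have [r [_ rB]] := compact_bounded cB.
have {}rB x : B x -> `|x| <= r + 1 by apply: rB; rewrite ltrDl.
have [dl dl0 dP] := compact_uniformly_continuous cB cg e0.
set n1 : R := #|unit_index d L0|%:R + 1.
have n10 : 0 < n1 by rewrite ltr_wpDl.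
pose E : R := 1 + \sum_(j < d) ((r + 1) ^+ 2 + (r + 1) ^+ 2).
have E0 : 0 < E by rewrite ltr_pwDl// sumr_ge0// => j _; rewrite addr_ge0 ?sqr_ge0.
have EB y k : B y -> site_energy k y <= E.
  move=> By; rewrite lerD2l ler_sum// => j _.
  have cle b : comp b k j y ^+ 2 <= (r + 1) ^+ 2.
    rewrite -real_normK ?num_real// lerXn2r ?nnegrE ?(le_trans _ (rB _ By))//.
    by rewrite (le_trans (comp_le _ _ _ _))// rB.
  by rewrite lerD.
(* The absolute value makes the speed visibly nonnegative. *)
pose c k := site_speed d m nu k `|M k|.
have c0 k : 0 <= c k.
  by rewrite mulr_ge0 ?expR_ge0// !addr_ge0// ?invr_ge0 ltW.
pose c' := 1 + \sum_(k <- L0) c k.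
have cc k : k \in L0 -> c k <= c'.
  move=> kL0; rewrite /c' (big_fsetD1 k)//= addrCA lerDl addr_ge0// big_seq sumr_ge0//.
have c'0 : 0 < c' by rewrite ltr_pwDl// sumr_ge0.
have move_le L x t k b j : (L0 `<=` L)%fset -> k \in L0 -> `|t| <= 1 ->
    B (phase_proj L0 (x : local_phase R d L)) ->
    `|comp b k j (Phi L t x) - comp b k j x| <= c' * E * `|t|.
  move=> L0L kL0 t1 Bx; have kL : k \in L by exact: (fsubsetP L0L).
  apply: (le_trans (flow_displacement (M := `|M k|) V_smooth (@Phi_flow L) _ _ _ kL _ _ _ t1)) => //.
    by move=> i y; rewrite (le_trans (force_le _ _ kL))// ler_norm.
  rewrite ler_wpM2r// ler_pM ?cc// ?(le_trans _ (site_energy_ge1 _ _))//.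
    exact: c0.
  have -> : site_energy k x = site_energy k (phase_proj L0 x).
    by congr (1 + _); apply: eq_bigr => i _; rewrite !comp_phase_proj.
  exact: EB.
(* Within this time every coordinate in [L0] moves by less than [dl / n1], hence the projected point
   by less than [dl]. *)
have small : 0 < dl / n1 / (c' * E) by rewrite !divr_gt0// mulr_gt0.
move: (@nbhs0_le R R 1 ltr01) (@nbhs0_lt R R _ small); apply: filterS2 => t t1 tE L L0L x.
rewrite ltr_pdivlMr ?mulr_gt0// mulrC in tE.
set y := phase_proj L x; set w := Phi L t y.
have yx : phase_proj L0 x = phase_proj L0 y.
  apply/val_inj/val_inj/funext => k /=; case: ifPn => // kL0.
  by rewrite (fsubsetP L0L _ kL0).
have close (u v : local_phase R d L) :
    (forall k b j, k \in L0 -> `|comp b k j u - comp b k j v| < dl / n1) ->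
    `|phase_proj L0 u - phase_proj L0 v| < dl.
  move=> uv; apply: (norm_coord_lt (@unit_vec_norm R d G L0)) => // i.
  by rewrite innerBr !inner_unit_vec !comp_phase_proj ?fsvalP// uv// fsvalP.
rewrite yx.
have [By|nBy] := pselect (B (phase_proj L0 y)).
  apply: dP => //; apply: close => k b j kL0; rewrite distrC.
  exact: le_lt_trans (move_le _ _ _ _ _ _ L0L kL0 t1 By) tE.
have [Bw|nBw] := pselect (B (phase_proj L0 w)).
  rewrite distrC; apply: dP => //; apply: close => k b j kL0; rewrite distrC.
  (* When only the end point projects into [B], the estimate is applied to the reversed motion
     starting from [w]. *)
  have -> : y = Phi L (- t) w.
    rewrite /w -(flowD V_smooth (@Phi_flow L)) addNr; by have [] := @Phi_flow L y.
  apply: le_lt_trans (move_le _ _ _ _ _ _ L0L kL0 _ Bw) _; rewrite normrN//.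
by rewrite (le_lt_trans (ler_normB _ _))// [ltRHS]splitr ltrD// gB.
Qed.

(** Has the form of the set in [Cstar_cvg], with the identity as limit of [alpha t] for [t] tending
    to 0. *)
Definition continuous_at0 : set (phase R d G -> R[i]) :=
  [set f | A f /\ forall e : R[i], 0 < e ->
    \forall t \near (0 : R), forall x, `|f x - alpha t f x| < e].

Lemma Cstar_subalgebra_continuous_at0 : Cstar_subalgebra continuous_at0.
Proof.
apply: (@Cstar_cvg _ _ _ _ AA _ (nbhs (0 : R)) _ alpha id).
- exact: CR_bounded.
- exact: (star_contraction_pullback A id).
- exact: evolution_contraction.
Qed.

Lemma frakK_loc_continuous_at0 L0 : frakK_loc L0 `<=` continuous_at0.
Proof.
move=> _ [g gC <-]; split; first exact: CR_C0_phase_proj.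
move=> e e0; have e2 : 0 < e / 2 by rewrite divr_gt0.
have := local_evolution_continuous0 gC e2; apply: filterS => t tP x.
have Ag := CR_C0_phase_proj gC.
have tot : \forall L \near summability.totally, (L0 `<=` L)%fset by exists L0.
(* [L] may depend on [t] and [x], since [tP] holds for all volumes containing [L0]. *)
have [L [L0L /(_ x) LP]] := filter_ex (filterI tot (local_evolution_cvg t Ag e2)).
have gE : local_evolution Phi L t (g \o phase_proj L0) x =
  g (phase_proj L0 (Phi L t (phase_proj L x))) by [].
rewrite gE in LP.
rewrite (_ : _ - _ = (g (phase_proj L0 x) - g (phase_proj L0 (Phi L t (phase_proj L x)))) -
  (alpha t (g \o phase_proj L0) x - g (phase_proj L0 (Phi L t (phase_proj L x))))).
  by rewrite [e]splitr (le_lt_trans (ler_normB _ _))// ltrD// tP.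
by rewrite /=; ring.
Qed.

Lemma frakK_continuous_at0 : frakK R d G `<=` continuous_at0.
Proof.
move=> f [g Kg [c ->]]; apply: (CstarD Cstar_subalgebra_continuous_at0).
  move: Kg; apply: Cstar_gen_sub; first exact: Cstar_subalgebra_continuous_at0.
  by move=> h [L _]; exact: frakK_loc_continuous_at0.
split; first exact: CR_cst.
by move=> e e0; apply: filterE => t x; rewrite evolution_cst subrr normr0.
Qed.

(** [alpha t] and [alpha s] commute, so the difference is the image under the contraction [alpha s]
    of [f - alpha t f]. *)
Lemma evolution_continuous_at0 s f : continuous_at0 f -> continuous_at0 (alpha s f).
Proof.
move=> [Af fc]; split; first exact: evolution_CR.
move=> e e0; have e2 : 0 < e / 2 by rewrite divr_gt0.
move: (fc _ e2); apply: filterS => t ft x.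
rewrite -evolutionD// [t + s]addrC evolutionD//.
apply: (@le_lt_trans _ _ (e / 2)); last by rewrite ltr_pdivrMr// ltr_pMr// ltr1n.
apply: (star_ctr_dist AA (evolution_contraction s)) => //.
- exact: evolution_CR.
- exact: ltW.
- by move=> y; rewrite ltW.
Qed.

Lemma frakL_continuous_at0 : frakL alpha `<=` continuous_at0.
Proof.
apply: Cstar_gen_sub; first exact: Cstar_subalgebra_continuous_at0.
by move=> h [t _ [g Kg <-]]; apply: evolution_continuous_at0; exact: frakK_continuous_at0.
Qed.

Lemma Cstar_subalgebra_frakL : Cstar_subalgebra (frakL alpha).
Proof.
apply: Cstar_subalgebra_gen => h [t _ [g Kg <-]].
by apply: (Cstar_Cb AA); apply: evolution_CR; exact: frakK_CR.
Qed.

(** By the group law the generator [alpha s g] is sent to the generator [alpha (t + s) g]. *)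
Lemma evolution_frakL t f : frakL alpha f -> frakL alpha (alpha t f).
Proof.
move=> Lf; pose B := [set f | A f /\ frakL alpha (alpha t f)].
suff : frakL alpha `<=` B by move=> /(_ f Lf)[].
apply: Cstar_gen_sub.
  exact: (Cstar_preimage AA Cstar_subalgebra_frakL (evolution_contraction t)).
move=> h [s _ [g Kg <-]]; have Ag := frakK_CR Kg; split; first exact: evolution_CR.
by rewrite -evolutionD//; apply: sub_Cstar_gen; exists (t + s) => //; exists g.
Qed.

Lemma evolution_frakL_automorphism t : star_automorphism (frakL alpha) (alpha t).
Proof.
have [aA _] := alpha_dyn t; have [_ inj _] := star_aut_bij aA; split.
- split.
  + by move=> f; exact: evolution_frakL.
  + move=> f g /set_mem/frakL_CR Af /set_mem/frakL_CR Ag fg.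
    exact: (inj _ _ (mem_set Af) (mem_set Ag) fg).
  (* Surjectivity on the subalgebra uses its invariance under the inverse evolution. *)
  + move=> f Lf; exists (alpha (- t) f); first exact: evolution_frakL.
    by apply: evolutionK; exact: frakL_CR.
- by move=> f g /frakL_CR Af /frakL_CR Ag; exact: (star_autD aA).
- by move=> c f /frakL_CR Af; exact: (star_autZ aA).
- by move=> f g /frakL_CR Af /frakL_CR Ag; exact: (star_autM aA).
- by move=> f /frakL_CR Af; exact: (star_autJ aA).
Qed.

Lemma frakL_dynamical_system : Cstar_dynamical_system (frakL alpha) alpha.
Proof.
split.
- exact: Cstar_subalgebra_frakL.
- exact: evolution_frakL_automorphism.
- by move=> f /frakL_CR; exact: evolution0.
- by move=> s t f /frakL_CR; exact: evolutionD.
move=> f /[dup] /frakL_CR Af /frakL_continuous_at0 [_ fc] t.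
apply/(cvg_uniformP (nbhs_filter t)) => e e0.
have e2 : 0 < e / 2 by rewrite divr_gt0.
have : \forall s \near t, forall x, `|f x - alpha (s - t) f x| < e / 2.
  have c : (fun s : R => s - t) @ t --> (0 : R).
    rewrite -[X in _ --> X](subrr t); apply: cvgB; [exact: cvg_id|exact: cvg_cst].
  exact: c (fc _ e2).
apply: filterS => s sf x.
(* Continuity at [t] follows from continuity at 0 because [alpha t] is contractive. *)
have -> : alpha s f = alpha t (alpha (s - t) f) by rewrite -evolutionD// subrKC.
apply: (@le_lt_trans _ _ (e / 2)); last by rewrite ltr_pdivrMr// ltr_pMr// ltr1n.
apply: (star_ctr_dist AA (evolution_contraction t)) => //.
- exact: evolution_CR.
- exact: ltW.
- by move=> y; rewrite ltW.
Qed.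

End InfiniteVolume.

Unset Implicit Arguments.

Theorem theorem21 (R : realType) (d : nat) (d_ge1 : (1 <= d)%N)
  (Gamma : countType) (m nu : Gamma -> R)
  (m_gt0 : forall k, 0 < m k) (nu_gt0 : forall k, 0 < nu k)
  (V : Gamma -> Gamma -> 'rV[R]_d -> R)
  (* (i) *)
  (V_sym : forall k l x, V k l x = V l k (- x))
  (* (ii) *)
  (V_C0oo : forall k l, smooth (V k l) /\ vanishes_at_infinity (V k l))
  (* (iii a) *)
  (C : R) (Cc : Gamma -> Gamma -> R)
  (C_ge0 : 0 <= C) (Cc_ge0 : forall k l, 0 <= Cc k l)
  (V_bound : forall k l (beta : 'I_d -> nat) x,
     `|mpartial beta (V k l) x| <= Cc k l * C ^+ (\sum_(j < d) beta j)%N)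
  (* (iii b) *)
  (Cc_sup : (ereal_sup [set \esum_(l in [set: Gamma]) (Cc k l)%:E
                        | k in [set: Gamma]] < +oo)%E)
  (* (iv) *)
  (mnu_sup : (ereal_sup ([set (m k * nu k)%:E | k in [set: Gamma]] `|`
                         [set (1 / (m k * nu k))%:E | k in [set: Gamma]])
              < +oo)%E)
  (Phi : forall L : {fset Gamma}, R -> local_phase R d L -> local_phase R d L)
  (Phi_flow : forall L : {fset Gamma},
     is_hamiltonian_flow (hamiltonian m nu V (L := L)) (Phi L))
  (alpha : R -> (phase R d Gamma -> R[i]) -> (phase R d Gamma -> R[i]))
  (alpha_dyn : is_infinite_volume_dynamics Phi alpha) :
  frakL alpha `<=` CR (phase R d Gamma) /\
  Cstar_dynamical_system (frakL alpha) alpha.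
Proof.
have V_smooth k l : smooth (V k l) by have [] := V_C0oo k l.
(* One force bound per site, valid in all volumes at once. *)
pose M k := sval (cid (force_bound V_sym V_smooth C_ge0 Cc_ge0 V_bound Cc_sup k)).
have force_le k (L : {fset Gamma}) j (x : local_phase R d L) :
    k \in L -> `|force V k j x| <= M k.
  exact: (svalP (cid (force_bound V_sym V_smooth C_ge0 Cc_ge0 V_bound Cc_sup k))).
split; first by move=> f; exact: (frakL_CR alpha_dyn).
exact: (frakL_dynamical_system m_gt0 nu_gt0 V_smooth force_le Phi_flow alpha_dyn).
Qed.
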